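(* Let $\mathcal N$ be a field of totally null 2-planes on $(\mathcal M,g)$, where $g$ is a 4-dimensional real metric of Riemannian or split signature. Assume that $\mathcal N$ is integrable, $[\mathcal N,\mathcal N]\subset\mathcal N$, and that it has real index $0$ everywhere on $\mathcal M$. Then there exists a canonical Weyl connection $\nabla^W$ on $\mathcal M$. It is uniquely determined by the requirements that it is real, it is torsionless, it satisfies $\nabla^Wg=-B\otimes g$ for some (real) 1-form $B$, and it satisfies $\nabla^W_X\mathcal N\subset\mathcal N$ for all $X\in{\rm T}\mathcal M$. In terms of a coframe $(\theta^a)$ adapted to $\mathcal N$ (and satisfying the reality conditions below) and the connection 1-forms $\Gamma^{W\,a}{}_b=g^{ad}\Gamma^W_{dbc}\theta^c$, the connection $\nabla^W$ is given by $$\Gamma^W_{abc}=\Gamma_{abc}+\tfrac12(g_{ca}B_b-g_{cb}B_a+g_{ab}B_c)$$ with $$\tfrac12B=\Gamma_{143}\theta^1+\Gamma_{234}\theta^2+\Gamma_{321}\theta^3+\Gamma_{412}\theta^4,$$ where $\Gamma_{abc}$ are the Levi-Civita connection coefficients in the adapted coframe.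
   Context: $g$ is extended complex-bilinearly to ${\rm T}^{\mathbb C}\mathcal M$. A field of totally null 2-planes is a complex rank-2 subbundle $\mathcal N\subset{\rm T}^{\mathbb C}\mathcal M$ with $g_{|\mathcal N}\equiv0$. Its real index at a point is $\dim_{\mathbb C}(\mathcal N\cap\overline{\mathcal N})$; real index $0$ means ${\rm T}^{\mathbb C}\mathcal M=\mathcal N\oplus\overline{\mathcal N}$. A coframe adapted to $\mathcal N$ is a local complex coframe $(\theta^1,\theta^2,\theta^3,\theta^4)$ with $g=2(\theta^1\theta^2+\theta^3\theta^4)$ (symmetrized products, so $g_{12}=g_{34}=1$ and the remaining components not related by symmetry vanish) such that, for the dual frame $(e_a)$, $\mathcal N={\rm Span}_{\mathbb C}(e_1,e_4)$; the reality conditions are $\theta^2=\overline{\theta^1}$ together with $\theta^4=\overline{\theta^3}$ in Riemannian signature, and $\theta^2=\overline{\theta^1}$ together with $\theta^4=-\overline{\theta^3}$ in split signature. Connection coefficients: $\nabla_{e_c}e_b=\Gamma^a{}_{bc}e_a$, $\Gamma_{abc}=g_{ad}\Gamma^d{}_{bc}$ for the Levi-Civita connection (so $\Gamma_{abc}=-\Gamma_{bac}$), and $\nabla^W_{e_c}e_b=g^{ad}\Gamma^W_{dbc}e_a$. *)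

(* Defs.v *)
From HB Require Import structures.
From mathcomp Require Import all_boot all_order all_algebra.
From mathcomp Require Export complex.
From mathcomp Require Export all_classical all_reals topology normedtype derive.
Export numFieldNormedType.Exports.
Set Implicit Arguments.
Unset Strict Implicit.
Unset Printing Implicit Defensive.
Import Order.TTheory GRing.Theory Num.Theory.
Local Open Scope classical_set_scope.
Local Open Scope ring_scope.
Local Open Scope complex_scope.

Section Calculus.
Variables (R : realType) (n : nat).

Definition partial (i : 'I_n) (f : 'rV[R]_n -> R) (x : 'rV[R]_n) : R :=
  'D_(delta_mx 0 i) f x.

(* Only meant for open V; the values of f outside V are irrelevant. *)
Fixpoint C_on (k : nat) (V : set 'rV[R]_n) (f : 'rV[R]_n -> R) : Prop :=
  match k with
  | 0 => forall x, V x -> {for x, continuous f}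
  | k'.+1 => (forall x, V x -> differentiable f x) /\
             (forall i, C_on k' V (partial i f))
  end.

Definition smooth_on (V : set 'rV[R]_n) (f : 'rV[R]_n -> R) : Prop :=
  forall k, C_on k V f.

End Calculus.

Record chart (R : realType) (n : nat) (M : topologicalType) := Chart {
  cdom : set M;
  cmap : M -> 'rV[R]_n;
  cinv : 'rV[R]_n -> M;
  cdom_open : open cdom;
  cimg_open : open (cmap @` cdom);
  cmapK : forall q, cdom q -> cinv (cmap q) = q;
  cmap_continuous : forall q, cdom q -> {for q, continuous cmap};
  cinv_continuous : forall x, (cmap @` cdom) x -> {for x, continuous cinv} }.

(* [chart_at p] is a preferred chart around p.  It is only used to represent
   tangent vectors and covectors at p by their coordinates, see below. *)
Record manifold (R : realType) (n : nat) := Manifold {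
  carrier :> topologicalType;
  carrier_hausdorff : hausdorff_space carrier;
  carrier_second_countable : @second_countable carrier;
  atlas : set (chart R n carrier);
  chart_at : carrier -> chart R n carrier;
  chart_at_atlas : forall p, atlas (chart_at p);
  chart_at_dom : forall p, cdom (chart_at p) p;
  atlas_smooth : forall c c', atlas c -> atlas c' -> forall i,
    smooth_on (cmap c @` (cdom c `&` cdom c'))
              (fun x => cmap c' (cinv c x) 0 i) }.

Section Fields.
Variables (R : realType) (n : nat) (M : manifold R n).
Local Notation C := R[i].

Definition toC m k (A : 'M[R]_(m, k)) : 'M[C]_(m, k) :=
  map_mx (fun x : R => x%:C) A.
Definition conjM m k (A : 'M[C]_(m, k)) : 'M[C]_(m, k) :=
  map_mx (fun z : C => z^*) A.

Definition real_smooth (U : set M) (f : M -> R) : Prop :=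
  forall c, atlas c ->
    smooth_on (cmap c @` (U `&` cdom c)) (fun x => f (cinv c x)).

Definition smooth_fun (U : set M) (f : M -> C) : Prop :=
  real_smooth U (fun q => complex.Re (f q)) /\
  real_smooth U (fun q => complex.Im (f q)).

(* A vector of T_p^C M is the row of its components in the coordinates
   [chart_at p]; a complex vector field is a map M -> 'rV[C]_n.
   [components c X q] are the components of X q in the chart c. *)
Definition components (c : chart R n M) (X : M -> 'rV[C]_n) (q : M) : 'rV[C]_n :=
  X q *m toC (jacobian (fun x => cmap c (cinv (chart_at q) x))
                       (cmap (chart_at q) q)).

Definition smooth_field (U : set M) (X : M -> 'rV[C]_n) : Prop :=
  forall c, atlas c -> forall i,
    smooth_fun (U `&` cdom c) (fun q => components c X q 0 i).

Definition smooth_field_near (p : M) (X : M -> 'rV[C]_n) : Prop :=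
  exists U : set M, [/\ open U, U p & smooth_field U X].

Definition smooth_fun_near (p : M) (f : M -> C) : Prop :=
  exists U : set M, [/\ open U, U p & smooth_fun U f].

Definition dir_deriv (p : M) (v : 'rV[C]_n) (f : M -> C) : C :=
  \sum_i v 0 i *
    ((partial i (fun x => complex.Re (f (cinv (chart_at p) x)))
              (cmap (chart_at p) p))
     +i* (partial i (fun x => complex.Im (f (cinv (chart_at p) x)))
              (cmap (chart_at p) p))).

Definition bracket (X Y : M -> 'rV[C]_n) (p : M) : 'rV[C]_n :=
  \row_k (dir_deriv p (X p) (fun q => components (chart_at p) Y q 0 k)
        - dir_deriv p (Y p) (fun q => components (chart_at p) X q 0 k)).

(* Covectors at p are the rows of their components in the basis dual to the
   coordinate basis of [chart_at p]. *)
Definition pairing (w v : 'rV[C]_n) : C := \sum_i w 0 i * v 0 i.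

Definition smooth_form (U : set M) (w : M -> 'rV[C]_n) : Prop :=
  forall V X, open V -> V `<=` U -> smooth_field V X ->
    smooth_fun V (fun q => pairing (w q) (X q)).

Definition real_one_form (B : M -> 'rV[R]_n) : Prop :=
  smooth_form setT (fun q => toC (B q)).

Definition inner (A : 'M[R]_n) (u v : 'rV[C]_n) : C :=
  (u *m toC A *m v^T) 0 0.

Record metric := Metric {
  gram :> M -> 'M[R]_n;
  gram_sym : forall p, (gram p)^T = gram p;
  gram_nondegenerate : forall p, gram p \in unitmx;
  gram_smooth : forall U X Y, open U -> smooth_field U X -> smooth_field U Y ->
    smooth_fun U (fun q => inner (gram q) (X q) (Y q)) }.

(* [cov p v Y] is the covariant derivative at p of the field Y in the direction
   v; its value is meaningful only when Y is smooth near p. *)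
Record connection := Connection {
  cov :> forall p : M, 'rV[C]_n -> (M -> 'rV[C]_n) -> 'rV[C]_n;
  cov_linear : forall p (a : C) u v Y, smooth_field_near p Y ->
    cov p (a *: u + v) Y = a *: cov p u Y + cov p v Y;
  cov_add : forall p v Y Z, smooth_field_near p Y -> smooth_field_near p Z ->
    cov p v (fun q => Y q + Z q) = cov p v Y + cov p v Z;
  cov_leibniz : forall p v f Y, smooth_fun_near p f -> smooth_field_near p Y ->
    cov p v (fun q => f q *: Y q) = dir_deriv p v f *: Y p + f p *: cov p v Y;
  cov_smooth : forall U X Y, open U -> smooth_field U X -> smooth_field U Y ->
    smooth_field U (fun q => cov q (X q) Y) }.

Definition same_connection (D D' : connection) : Prop :=
  forall p v Y, smooth_field_near p Y -> D p v Y = D' p v Y.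

Definition real_connection (D : connection) : Prop :=
  forall p v Y, smooth_field_near p Y ->
    D p (conjM v) (fun q => conjM (Y q)) = conjM (D p v Y).

Definition torsionless (D : connection) : Prop :=
  forall p X Y, smooth_field_near p X -> smooth_field_near p Y ->
    D p (X p) Y - D p (Y p) X = bracket X Y p.

Definition nabla_metric (D : connection) (g : metric) (p : M) (v : 'rV[C]_n)
    (X Y : M -> 'rV[C]_n) : C :=
  dir_deriv p v (fun q => inner (g q) (X q) (Y q))
  - inner (g p) (D p v X) (Y p) - inner (g p) (X p) (D p v Y).

Definition levi_civita (g : metric) (D : connection) : Prop :=
  [/\ real_connection D, torsionless D &
      forall p v X Y, smooth_field_near p X -> smooth_field_near p Y ->
        nabla_metric D g p v X Y = 0].

Definition weyl_condition (g : metric) (D : connection) (B : M -> 'rV[R]_n) : Prop :=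
  forall p v X Y, smooth_field_near p X -> smooth_field_near p Y ->
    nabla_metric D g p v X Y
    = - (pairing (toC (B p)) v * inner (g p) (X p) (Y p)).

(* A field of subspaces of T^C M is given by matrices with these row spaces. *)
Definition section_of (N : M -> 'M[C]_n) (U : set M) (X : M -> 'rV[C]_n) : Prop :=
  smooth_field U X /\ forall q, U q -> (X q <= N q)%MS.

Definition rank2_subbundle (N : M -> 'M[C]_n) : Prop :=
  (forall p, \rank (N p) = 2) /\
  forall p, exists U X Y,
    [/\ open U, U p, smooth_field U X, smooth_field U Y &
        forall q, U q -> (N q == X q + Y q)%MS].

Definition totally_null (g : metric) (N : M -> 'M[C]_n) : Prop :=
  forall p (u v : 'rV[C]_n), (u <= N p)%MS -> (v <= N p)%MS -> inner (g p) u v = 0.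

Definition null_plane_field (g : metric) (N : M -> 'M[C]_n) : Prop :=
  rank2_subbundle N /\ totally_null g N.

Definition integrable (N : M -> 'M[C]_n) : Prop :=
  forall U X Y, open U -> section_of N U X -> section_of N U Y ->
    forall p, U p -> (bracket X Y p <= N p)%MS.

Definition real_index (N : M -> 'M[C]_n) (p : M) : nat :=
  \rank (N p :&: conjM (N p))%MS.

Definition preserves (D : connection) (N : M -> 'M[C]_n) : Prop :=
  forall p (v : 'rV[R]_n) U Y, open U -> U p -> section_of N U Y ->
    (D p (toC v) Y <= N p)%MS.

End Fields.

Section FourDimensional.
Variables (R : realType) (M : manifold R 4).
Local Notation C := R[i].

Inductive signature := Riemannian | Split.

Definition has_signature (s : signature) (g : metric M) : Prop :=
  match s with
  | Riemannian => forall p (v : 'rV[R]_4), v != 0 -> 0 < (v *m g p *m v^T) 0 0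
  | Split => forall p, exists2 P : 'M[R]_4, P \in unitmx &
      P *m g p *m P^T = diag_mx (\row_(i < 4) if (i < 2)%N then 1 else -1)
  end.

Definition i1 : 'I_4 := @Ordinal 4 0 isT.
Definition i2 : 'I_4 := @Ordinal 4 1 isT.
Definition i3 : 'I_4 := @Ordinal 4 2 isT.
Definition i4 : 'I_4 := @Ordinal 4 3 isT.

(* Row a of th q is theta^a at q; row b of dual_frame th q is e_b at q. *)
Definition dual_frame (th : M -> 'M[C]_4) (q : M) : 'M[C]_4 := (invmx (th q))^T.
Definition theta (th : M -> 'M[C]_4) (a : 'I_4) (q : M) : 'rV[C]_4 := row a (th q).
Definition frame (th : M -> 'M[C]_4) (b : 'I_4) (q : M) : 'rV[C]_4 :=
  row b (dual_frame th q).

Definition is_coframe (U : set M) (th : M -> 'M[C]_4) : Prop :=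
  (forall a, smooth_form U (theta th a)) /\ forall q, U q -> th q \in unitmx.

Definition adapted_coframe (g : metric M) (N : M -> 'M[C]_4) (U : set M)
    (th : M -> 'M[C]_4) : Prop :=
  [/\ is_coframe U th,
      forall q, U q -> forall u v : 'rV[C]_4,
        let t a w := pairing (theta th a q) w in
        inner (g q) u v = t i1 u * t i2 v + t i2 u * t i1 v
                        + t i3 u * t i4 v + t i4 u * t i3 v &
      forall q, U q -> (N q == frame th i1 q + frame th i4 q)%MS].

Definition reality_conditions (s : signature) (U : set M) (th : M -> 'M[C]_4) : Prop :=
  forall q, U q ->
    theta th i2 q = conjM (theta th i1 q) /\
    theta th i4 q = match s with
                    | Riemannian => conjM (theta th i3 q)
                    | Split => - conjM (theta th i3 q)
                    end.

Definition Gamma_up (D : connection M) (th : M -> 'M[C]_4) (a b c : 'I_4) (p : M) : C :=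
  pairing (theta th a p) (D p (frame th c p) (frame th b)).

Definition g_low (g : metric M) (th : M -> 'M[C]_4) (a b : 'I_4) (p : M) : C :=
  inner (g p) (frame th a p) (frame th b p).

Definition Gamma (g : metric M) (D : connection M) (th : M -> 'M[C]_4)
    (a b c : 'I_4) (p : M) : C :=
  \sum_d g_low g th a d p * Gamma_up D th d b c p.

Definition canonical_weyl (g : metric M) (N : M -> 'M[C]_4) (W : connection M) : Prop :=
  [/\ real_connection W,
      torsionless W,
      exists2 B : M -> 'rV[R]_4, real_one_form B & weyl_condition g W B &
      preserves W N].

End FourDimensional.

(* Main.v *)
Require Import Defs.
From mathcomp Require Import all_boot all_order all_algebra.
From mathcomp Require Import complex all_classical all_reals topology normedtype derive.
From mathcomp Require Import landau realfun interval_inference ring lra.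
Set Implicit Arguments.
Unset Strict Implicit.
Unset Printing Implicit Defensive.
Import Order.TTheory GRing.Theory Num.Theory.
Local Open Scope classical_set_scope.
Local Open Scope ring_scope.
Local Open Scope complex_scope.

(* Near each point N has a basis e1, e4; since the real index is 0 and N is null,
   conj N has a basis e2, e3 dual to it under g, so that (e_a) is a complex frame
   with constant null Gram matrix.  The connection coefficients of a torsionless D
   with D g = - B g differ from the Levi-Civita ones by the terms in B of the
   theorem, and preserving N and conj N means that the coefficients (1,4,c) and
   (2,3,c) vanish.  This fixes B, and integrability of N makes all these equations
   consistent.  The equations at a point involve only germs at that point, hence the
   operators defined by different local frames agree and glue to a global
   connection, and the complex conjugate connection solves the same equations,
   hence the connection and B are real.  Independence of the bracket from the chart
   rests on the symmetry of second derivatives. *)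

(** * Partial derivatives on R^n *)

(** The components of B come from the positions (1,4,3), (2,3,4), (3,2,1), (4,1,2): there the
    difference formula contains a single component of B, because g12 = g34 = 1 are the only entries
    left, and the Weyl coefficient has to vanish. The positions (1,4,1), (1,4,4), (2,3,2), (2,3,3)
    contain no B; their Levi-Civita coefficients are g([e1, e4], e1) and its analogues, which
    involutivity makes zero.

    The local frames are not asked to satisfy reality conditions, so that one construction serves
    both signatures; the price is that a local operator is not visibly real. Hence all pointwise
    notions allow complex operators and complex covectors, and [weyl_at] demands that both N and
    conj N be preserved. For a real connection the second demand follows from the first.

    Tangent vectors at q are stored in the chart [chart_at q], which may jump with q. Smoothness of
    derivatives and brackets is therefore proved by rewriting them in one fixed chart. *)

Section Calculus.
Variables (R : realType) (n : nat).
Local Notation V := 'rV[R]_n.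

(** The difference [h \- f] vanishes near x, so it has the zero map as differential, and h is f plus
    this difference. *)
Lemma near_eq_differentiable (U W : normedModType R) (f h : U -> W) (x : U) :
  (\near x, f x = h x) -> differentiable f x -> differentiable h x.
Proof.
move=> fh df.
have hx : f x = h x := nbhs_singleton fh.
suff d0 : differentiable (h \- f) x.
  have -> : h = f + (h \- f) by rewrite funeqE => y /=; rewrite addrC subrK.
  exact: differentiableD.
apply/diff_locallyP.
have z : ((h \- f) \o shift x : U -> W) = cst ((h \- f) x) + (\0 : {linear U -> W}) +o_ 0 id.
  apply/eqaddoP => _ /posnumP[e]; near=> y.
  rewrite /= -[X in `|X|]/((h (y + x) - f (y + x)) - ((h x - f x) + 0)).
  rewrite hx subrr addr0 subr0.
  suff -> : f (y + x) = h (y + x) by rewrite subrr normr0 mulr_ge0.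
  near: y; have := fh; rewrite (near_shift 0)/= subr0.
  by apply: filterS => y.
have c0 : continuous (\0 : {linear U -> W}) by exact: cst_continuous.
by have -> := diff_unique c0 z.
Unshelve. all: by end_near. Qed.

Lemma partialE i (f : V -> R) x :
  differentiable f x -> partial i f x = 'd f x (delta_mx 0 i).
Proof. exact: deriveE. Qed.

Lemma eq_partial i (f h : V -> R) x :
  (\near x, f x = h x) -> partial i f x = partial i h x.
Proof. exact: near_eq_derive. Qed.

Lemma partial_cst i (a : R) (x : V) : partial i (fun=> a) x = 0.
Proof. exact: derive_cst. Qed.

Lemma partialD i (f h : V -> R) x : differentiable f x -> differentiable h x ->
  partial i (fun y => f y + h y) x = partial i f x + partial i h x.
Proof. by move=> df dh; apply: deriveD; apply: diff_derivable. Qed.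

Lemma partialN i (f : V -> R) x : differentiable f x ->
  partial i (fun y => - f y) x = - partial i f x.
Proof. by move=> df; apply: deriveN; apply: diff_derivable. Qed.

Lemma partialM i (f h : V -> R) x : differentiable f x -> differentiable h x ->
  partial i (fun y => f y * h y) x = f x * partial i h x + h x * partial i f x.
Proof. by move=> df dh; apply: deriveM; apply: diff_derivable. Qed.

Lemma partialV i (f : V -> R) x : differentiable f x -> f x != 0 ->
  partial i (fun y => (f y)^-1) x = - ((f x)^-1 * (f x)^-1 * partial i f x).
Proof.
move=> df f0; rewrite [LHS]deriveV //; last exact: diff_derivable.
by rewrite /partial expr2 invfM scaleNr.
Qed.

Lemma C_on_sub k (A B : set V) f : B `<=` A -> C_on k A f -> C_on k B f.
Proof.
move=> BA; elim: k f => [|k IH] f /=; first by move=> fA x /BA /fA.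
by case=> df pf; split=> [x /BA /df|i]; [|exact: IH].
Qed.

(** The sets B may be arbitrary, not only open: [C_on] is a pointwise condition on ambient functions
    and their partials, never on restrictions. *)
Lemma C_on_local k (A : set V) f :
  (forall x, A x -> exists2 B, B x & C_on k B f) -> C_on k A f.
Proof.
elim: k f => [|k IH] f /= fA; first by move=> x /fA [B Bx]; apply.
split=> [x /fA [B Bx []]|i]; first by move=> + _; apply.
by apply: IH => x /fA [B Bx [_ fB]]; exists B.
Qed.

(** Openness of A turns equality on A into equality of germs, so that the partials agree on A as
    well and the induction continues. *)
Lemma C_on_ext k (A : set V) f h : open A -> (forall x, A x -> f x = h x) ->
  C_on k A f -> C_on k A h.
Proof.
move=> oA; elim: k f h => [|k IH] f h fh /=.
  move=> fc x Ax.
  have fhx : \near x, f x = h x.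
    by apply: filterS fh _; exact: open_nbhs_nbhs.
  have fcx := fc x Ax; rewrite /prop_for /continuous_at (fh x Ax) in fcx *.
  apply: (cvg_trans _ fcx). exact: (near_eq_cvg fhx).
have fhx x : A x -> \near x, f x = h x.
  by move=> Ax; apply: filterS fh _; exact: open_nbhs_nbhs.
case=> df pf; split=> [x Ax|i]; first exact: near_eq_differentiable (fhx x Ax) (df x Ax).
apply: IH (pf i) => x Ax; exact: eq_partial (fhx x Ax).
Qed.

Lemma C_onS k (A : set V) f : C_on k.+1 A f -> C_on k A f.
Proof.
elim: k f => [|k IH] f [df pf] /=.
  by move=> x Ax; apply: differentiable_continuous; exact: df.
by split=> // i; apply: IH.
Qed.

Lemma C_on_cst k (A : set V) a : open A -> C_on k A (fun=> a).
Proof.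
move=> oA; elim: k a => [|k IH] a /=; first by move=> x _; exact: cst_continuous.
split=> [x _|i]; first exact: differentiable_cst.
by apply: (C_on_ext (f := fun=> 0)) => // x _; rewrite partial_cst.
Qed.

Lemma C_onD k (A : set V) f h : open A -> C_on k A f -> C_on k A h ->
  C_on k A (fun x => f x + h x).
Proof.
move=> oA; elim: k f h => [|k IH] f h /=.
  by move=> cf ch x Ax; apply: continuousD; [exact: cf|exact: ch].
move=> [df pf] [dh ph]; split=> [x Ax|i].
  by apply: differentiableD; [exact: df|exact: dh].
apply: C_on_ext (IH _ _ (pf i) (ph i)) => // x Ax.
by rewrite partialD //; [exact: df|exact: dh].
Qed.

Lemma C_onN k (A : set V) f : open A -> C_on k A f ->
  C_on k A (fun x => - f x).
Proof.
move=> oA; elim: k f => [|k IH] f /=.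
  by move=> cf x Ax; apply: continuousN; exact: cf.
move=> [df pf]; split=> [x Ax|i].
  by apply: differentiableN; exact: df.
apply: C_on_ext (IH _ (pf i)) => // x Ax.
by rewrite partialN //; exact: df.
Qed.

Lemma C_onM k (A : set V) f h : open A -> C_on k A f -> C_on k A h ->
  C_on k A (fun x => f x * h x).
Proof.
move=> oA; elim: k f h => [|k IH] f h.
  by move=> cf ch x Ax; apply: continuousM; [exact: cf|exact: ch].
move=> Cf Ch; have [df pf] := Cf; have [dh ph] := Ch; split=> [x Ax|i].
  by apply: differentiableM; [exact: df|exact: dh].
apply: C_on_ext (C_onD oA (IH _ _ (C_onS Cf) (ph i)) (IH _ _ (C_onS Ch) (pf i))) => //.
by move=> x Ax; rewrite partialM //; [exact: df|exact: dh].
Qed.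

Lemma C_onV k (A : set V) f : open A -> (forall x, A x -> f x != 0) ->
  C_on k A f -> C_on k A (fun x => (f x)^-1).
Proof.
move=> oA f0; elim: k => [|k IH].
  by move=> cf x Ax; apply: continuousV; [exact: f0|exact: cf].
move=> Cf; have [df pf] := Cf; split=> [x Ax|i].
  by apply: differentiableV; [exact: df|exact: f0].
have CV := IH (C_onS Cf).
apply: C_on_ext (C_onN oA (C_onM oA (C_onM oA CV CV) (pf i))) => //.
by move=> x Ax; rewrite partialV //; [exact: df|exact: f0].
Qed.

Lemma diff_coord (U : normedModType R) m (f : U -> 'rV[R]_m) x :
  (forall j, differentiable (fun y => f y 0 j) x) -> differentiable f x.
Proof.
move=> df.
have -> : f = \sum_j (fun y => f y 0 j *: (delta_mx 0 j : 'rV[R]_m)).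
  by rewrite funeqE => y; rewrite fct_sumE [LHS]row_sum_delta.
by apply: differentiable_sum => j; apply: differentiableZl.
Qed.

Lemma partial_comp (f : V -> R) (phi : V -> V) i x :
  (forall j, differentiable (fun y => phi y 0 j) x) ->
  differentiable f (phi x) ->
  partial i (f \o phi) x =
  \sum_j partial i (fun y => phi y 0 j) x * partial j f (phi x).
Proof.
move=> dphij df; have dphi := diff_coord dphij.
have dphiE : 'd phi x (delta_mx 0 i) = \row_j partial i (fun y => phi y 0 j) x.
  rewrite -deriveE // derive_mx; last exact: diff_derivable.
  by apply/rowP => j; rewrite !mxE.
rewrite partialE; last exact: differentiable_comp.
rewrite diff_comp //= dphiE [X in 'd f _ X]row_sum_delta linear_sum.
by apply: eq_bigr => j _; rewrite linearZ /= mxE -partialE.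
Qed.

(** With row vectors, the direction of differentiation is the row index of the Jacobian; vectors
    therefore multiply Jacobians from the left. *)
Lemma jacobianE m (phi : V -> 'rV[R]_m) i j (x : V) :
  (forall j, differentiable (fun y => phi y 0 j) x) ->
  jacobian phi x i j = partial i (fun y => phi y 0 j) x.
Proof.
move=> dphij; have dphi := diff_coord dphij.
have : ('D_(delta_mx 0 i) phi x) 0 j = ((delta_mx 0 i : V) *m jacobian phi x) 0 j.
  by rewrite (deriveEjacobian _ dphi).
rewrite derive_mx; last exact: diff_derivable.
by rewrite -rowE !mxE.
Qed.

Lemma is_derive_line (f : V -> R) x v (t : R) : derivable f (x + t *: v) v ->
  is_derive t (1 : R) (fun s : R => f (x + s *: v)) ('D_v f (x + t *: v)).
Proof.
have E : (fun h : R => h^-1 *: (((fun s : R => f (x + s *: v)) \o shift t) (h *: (1 : R))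
      - f (x + t *: v))) =
    (fun h : R => h^-1 *: ((f \o shift (x + t *: v)) (h *: v) - f (x + t *: v))).
  rewrite funeqE => h /=.
  by rewrite scalerDl [h *: (1 : R)]mulr1 addrCA.
by move=> df; apply: DeriveDef; [rewrite /derivable E|rewrite /derive E].
Qed.

Lemma MVT_line (f : V -> R) x v t : 0 < t ->
  (forall a, 0 <= a <= t -> differentiable f (x + a *: v)) ->
  exists2 a, 0 <= a <= t & f (x + t *: v) - f x = 'D_v f (x + a *: v) * t.
Proof.
move=> t0 df.
have dl a : 0 <= a <= t -> is_derive a (1 : R) (fun s : R => f (x + s *: v))
    ('D_v f (x + a *: v)).
  by move=> /df dfa; apply: is_derive_line; exact: diff_derivable.
have dl' a : a \in `]0, t[%R -> is_derive a (1 : R) (fun s : R => f (x + s *: v))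
    ('D_v f (x + a *: v)).
  by rewrite in_itv /= => /andP[/ltW a0 /ltW at_]; apply: dl; rewrite a0.
have [|a at_ E] := MVT t0 dl'.
  apply: derivable_within_continuous => a; rewrite in_itv /= => /dl ?.
  exact: ex_derive.
exists a; last by move: E; rewrite scale0r addr0 subr0.
by move: at_; rewrite in_itv /= => /andP[/ltW -> /ltW ->].
Qed.

Lemma derive_translate (f : V -> R) u w y :
  'D_u (fun z => f (z + w)) y = 'D_u f (y + w).
Proof.
rewrite /derive; set d := (fun _ : R => _); set d' := (fun _ : R => _).
by have -> : d = d' by rewrite funeqE => s; rewrite /d /d' /= !addrA.
Qed.

(** Mean value theorem twice: along u for y |-> f(y + t v) - f(y), then along v for the derivative
    of f in direction u. The left side is symmetric in u and v, which is what the symmetry of second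
    derivatives exploits. *)
Lemma second_difference (f : V -> R) (u v : V) x t : 0 < t ->
  (forall a b, 0 <= a <= t -> 0 <= b <= t ->
    differentiable f (x + a *: u + b *: v) /\
    differentiable ('D_u f) (x + a *: u + b *: v)) ->
  exists a b, [/\ 0 <= a <= t, 0 <= b <= t &
    f (x + t *: u + t *: v) - f (x + t *: u) - f (x + t *: v) + f x
    = t * t * 'D_v ('D_u f) (x + a *: u + b *: v)].
Proof.
move=> t0 df.
have tt : 0 <= t <= t by rewrite ltW /=.
have t00 : 0 <= (0 : R) <= t by rewrite lexx ltW.
have df1 a : 0 <= a <= t -> differentiable f (x + t *: v + a *: u).
  by move=> at_; rewrite addrAC; have [] := df a t at_ tt.
have df0 a : 0 <= a <= t -> differentiable f (x + a *: u).
  by move=> at_; have [] := df a 0 at_ t00; rewrite scale0r addr0.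
pose h y := f (y + t *: v) - f y.
have sh a : (x + a *: u) + t *: v = x + t *: v + a *: u by rewrite addrAC.
have dsh a : 0 <= a <= t -> differentiable (fun y => f (y + t *: v)) (x + a *: u).
  move=> at_; apply: (@differentiable_comp _ _ _ _ (fun y => y + t *: v) f).
    by apply: differentiableD => //; exact: differentiable_cst.
  by rewrite sh; exact: df1.
have [|a at_ E] := @MVT_line h x u t t0.
  by move=> a at_; apply: differentiableB; [exact: dsh|exact: df0].
have hE : 'D_u h (x + a *: u) = 'D_u f (x + a *: u + t *: v) - 'D_u f (x + a *: u).
  rewrite /h deriveB; [|by apply: diff_derivable; exact: dsh|by apply: diff_derivable; exact: df0].
  by rewrite derive_translate.
have [|b bt F] := @MVT_line ('D_u f) (x + a *: u) v t t0.
  by move=> b bt; have [] := df a b at_ bt.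
exists a, b; split; [exact: at_|exact: bt|].
have -> : f (x + t *: u + t *: v) - f (x + t *: u) - f (x + t *: v) + f x =
    h (x + t *: u) - h x by rewrite /h; ring.
by rewrite E hE F; set X := 'D_v _ _; ring.
Qed.

Lemma ler_half_dist (p q z : R) : `|p - q| / 2 + `|p - q| / 2 <= `|p - z| + `|q - z|.
Proof. by have := ler_distD z p q; rewrite (distrC z q); lra. Qed.

(** Schwarz's theorem by contradiction. The symmetric second difference is t^2 times either mixed
    derivative, each at some point near x, so the two share a value, while continuity keeps each
    within half of their gap at x. *)
Lemma partial_partial i j (A : set V) f x : open A -> A x -> C_on 2 A f ->
  partial i (partial j f) x = partial j (partial i f) x.
Proof.
move=> oA Ax [df pf].
have dpf k y : A y -> differentiable (partial k f) y by move=> Ay; have [+ _] := pf k; apply.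
have cP k l : {for x, continuous (partial k (partial l f))}.
  by have [_ /(_ k)] := pf l; apply.
apply/eqP/negPn/negP => neq.
set P := partial i (partial j f) in neq *; set Q := partial j (partial i f) in neq *.
pose e := `|P x - Q x| / 2.
have e0 : 0 < e by rewrite divr_gt0 // normr_gt0 subr_eq0.
have /nbhs_normP[r /= r0 rP] : \forall y \near x,
    [/\ A y, `|P x - P y| < e & `|Q x - Q y| < e].
  have nA : \forall y \near x, A y by apply: open_nbhs_nbhs.
  have nP : \forall y \near x, `|P x - P y| < e.
    exact: (@cvgrPdist_lt _ _ _ _ _ _ _).1 (cP i j) _ e0.
  have nQ : \forall y \near x, `|Q x - Q y| < e.
    exact: (@cvgrPdist_lt _ _ _ _ _ _ _).1 (cP j i) _ e0.
  by apply: filterS3 nA nP nQ.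
pose u : V := delta_mx 0 i; pose v : V := delta_mx 0 j.
(* Room for the whole parallelogram: steps a, b <= t move x by at most t K = r / 2 < r; the summand
   1 keeps K positive. *)
pose K := `|u| + `|v| + 1.
have K0 : 0 < K by rewrite ltr_wpDl // addr_ge0.
pose t := r / 2 / K.
have t0 : 0 < t by rewrite !divr_gt0.
have small a b : 0 <= a <= t -> 0 <= b <= t -> `|x - (x + a *: u + b *: v)| < r.
  move=> /andP[a0 at_] /andP[b0 bt].
  rewrite -addrA opprD addNKr normrN.
  rewrite (le_lt_trans (ler_normD _ _)) // !normrZ !ger0_norm //.
  apply: (@le_lt_trans _ _ (t * K)).
    rewrite /K !mulrDr mulr1 -[leLHS]addr0; apply: lerD; last exact: ltW.
    by apply: lerD; exact: ler_wpM2r.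
  by rewrite /t divfK ?gt_eqF // ltr_pdivrMr // ltr_pMr // ltr1n.
have small' a b : 0 <= a <= t -> 0 <= b <= t -> `|x - (x + b *: v + a *: u)| < r.
  by move=> at_ bt; rewrite (addrAC x); exact: small.
have [|a [b [at_ bt E]]] := @second_difference f u v x t t0.
  by move=> a b at_ bt; have [/[dup] /df ? /(dpf i)] := rP _ (small a b at_ bt).
have [|c [d [ct dt F]]] := @second_difference f v u x t t0.
  by move=> c d ct dt; have [/[dup] /df ? /(dpf j)] := rP _ (small' d c dt ct).
have [_ _ Qe] := rP _ (small a b at_ bt).
have [_ Pe _] := rP _ (small' d c dt ct).
have PQ : P (x + c *: v + d *: u) = Q (x + a *: u + b *: v).
  have tt0 : t * t != 0 by rewrite mulf_neq0 // gt_eqF.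
  apply: (mulfI tt0); rewrite [LHS](esym F) [RHS](esym E).
  by rewrite (addrAC x) -!addrA; congr (_ + _); rewrite addrCA.
rewrite PQ in Pe.
by have /le_lt_trans/(_ (ltrD Pe Qe)) := ler_half_dist (P x) (Q x) (Q (x + a *: u + b *: v));
  rewrite ltxx.
Qed.

Lemma C_on_sum k (A : set V) m (F : 'I_m -> V -> R) : open A ->
  (forall j, C_on k A (F j)) -> C_on k A (fun x => \sum_j F j x).
Proof.
move=> oA CF; have -> : (fun x => \sum_j F j x) = \sum_j F j.
  by rewrite funeqE => x; rewrite fct_sumE.
elim/big_ind: _ => [|f h Cf Ch|j _]; [exact: C_on_cst|exact: C_onD|exact: CF].
Qed.

Lemma smooth_on_partial (A : set V) f i :
  smooth_on A f -> smooth_on A (partial i f).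
Proof. by move=> sf k; have [_] := sf k.+1; apply. Qed.

Lemma smooth_on_differentiable (A : set V) f x :
  smooth_on A f -> A x -> differentiable f x.
Proof. by move=> sf Ax; have [+ _] := sf 1%N; apply. Qed.

(** Induction on k for all f at once: the chain rule writes a partial of the composite as a sum of
    smooth functions times composites of partials of f, to which the induction hypothesis
    applies. *)
Lemma C_on_comp k (A B : set V) (f : V -> R) (phi : V -> V) : open A ->
  (forall x, A x -> B (phi x)) ->
  (forall j, smooth_on A (fun y => phi y 0 j)) ->
  C_on k B f -> C_on k A (f \o phi).
Proof.
move=> oA AB sphi.
have dj x (Ax : A x) j : differentiable (fun y => phi y 0 j) x.
  exact: smooth_on_differentiable (sphi j) Ax.
have dphi x (Ax : A x) : differentiable phi x by apply: diff_coord => j; exact: dj.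
elim: k f => [|k IH] f.
  move=> cf x Ax; apply: continuous_comp; last by apply: cf; exact: AB.
  by apply: differentiable_continuous; exact: dphi.
move=> [df pf]; split=> [x Ax|i].
  by apply: differentiable_comp; [exact: dphi|apply: df; exact: AB].
apply: (@C_on_ext _ _
    (fun x => \sum_j partial i (fun y => phi y 0 j) x * (partial j f \o phi) x)) => //.
  move=> x Ax; rewrite partial_comp //; first by move=> j; exact: dj.
  by apply: df; exact: AB.
apply: C_on_sum => // j; apply: C_onM => //; last by apply: IH; exact: pf.
by apply: smooth_on_partial; exact: sphi.
Qed.

Lemma partial_coord i j (x : V) : partial i (fun y : V => y 0 j) x = (i == j)%:R.
Proof.
have := @derive_id _ V x (delta_mx 0 i).
rewrite derive_mx; last exact: derivable_id.
by move=> /matrixP/(_ 0 j); rewrite !mxE eqxx /= eq_sym.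
Qed.

End Calculus.

(** * Smooth functions and fields in charts *)

Section Smooth.
Variables (R : realType) (n : nat) (M : manifold R n).
Local Notation C := R[i].
Implicit Types (c : chart R n M) (U V : set M) (p q : M).

(** The bridge between germs at q on M and germs at [cmap c q] in coordinates. *)
Lemma near_chart c q (P : set M) : cdom c q -> nbhs q P ->
  \forall x \near cmap c q,
    [/\ P (cinv c x), cdom c (cinv c x) & cmap c (cinv c x) = x].
Proof.
move=> cq nP; have iq : (cmap c @` cdom c) (cmap c q) by exists q.
have n1 : \forall x \near cmap c q, (cmap c @` cdom c) x.
  by apply: open_nbhs_nbhs; split=> //; exact: cimg_open.
have n2 : \forall x \near cmap c q, P (cinv c x).
  have := cinv_continuous iq; rewrite /prop_for /continuous_at cmapK //.
  by move=> H; exact: H nP.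
by apply: filterS2 n1 n2 => x [q' cq' <-]; rewrite cmapK.
Qed.

Lemma chart_image_open c U : open U -> open (cmap c @` (U `&` cdom c)).
Proof.
move=> oU; rewrite openE => x [q [Uq cq] <-]; rewrite /interior.
have := near_chart cq (open_nbhs_nbhs (conj oU Uq)).
by apply: filterS => y [Uy cy E]; exists (cinv c y).
Qed.

Lemma real_smooth_sub U V f : V `<=` U -> real_smooth U f -> real_smooth V f.
Proof.
move=> VU sf c ac k; apply: C_on_sub (sf c ac k).
by move=> _ [q [/VU Uq cq] <-]; exists q.
Qed.

Lemma real_smooth_local U f :
  (forall p, U p -> exists2 V, V p & real_smooth V f) -> real_smooth U f.
Proof.
move=> H c ac k; apply: C_on_local => x [p [Up cp] <-].
have [V Vp sV] := H p Up.
by exists (cmap c @` (V `&` cdom c)); [exists p|exact: sV].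
Qed.

Lemma real_smooth_ext U f h : open U -> (forall q, U q -> f q = h q) ->
  real_smooth U f -> real_smooth U h.
Proof.
move=> oU fh sf c ac k; apply: C_on_ext (sf c ac k); first exact: chart_image_open.
by move=> _ [q [Uq cq] <-]; rewrite cmapK // fh.
Qed.

Lemma real_smooth_cst U a : open U -> real_smooth U (fun=> a).
Proof. by move=> oU c ac k; apply: C_on_cst; exact: chart_image_open. Qed.

Lemma real_smoothD U f h : open U -> real_smooth U f -> real_smooth U h ->
  real_smooth U (fun q => f q + h q).
Proof.
move=> oU sf sh c ac k; apply: C_onD; first exact: chart_image_open.
  exact: sf.
exact: sh.
Qed.

Lemma real_smoothN U f : open U -> real_smooth U f ->
  real_smooth U (fun q => - f q).
Proof.
by move=> oU sf c ac k; apply: C_onN; [exact: chart_image_open|exact: sf].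
Qed.

Lemma real_smoothM U f h : open U -> real_smooth U f -> real_smooth U h ->
  real_smooth U (fun q => f q * h q).
Proof.
move=> oU sf sh c ac k; apply: C_onM; first exact: chart_image_open.
  exact: sf.
exact: sh.
Qed.

Lemma real_smoothV U f : open U -> (forall q, U q -> f q != 0) ->
  real_smooth U f -> real_smooth U (fun q => (f q)^-1).
Proof.
move=> oU f0 sf c ac k; apply: C_onV; first exact: chart_image_open.
  by move=> _ [q [Uq cq] <-]; rewrite cmapK //; exact: f0.
exact: sf.
Qed.

(** [real_smooth] quantifies over the whole atlas; smoothness of the transition maps reduces it to
    one chart that contains U. *)
Lemma real_smooth_one_chart c U f : atlas c -> open U -> U `<=` cdom c ->
  smooth_on (cmap c @` U) (fun x => f (cinv c x)) -> real_smooth U f.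
Proof.
move=> ac oU Uc sf c' ac' k; have oI : open (cmap c' @` (U `&` cdom c')) by exact: chart_image_open.
apply: (@C_on_ext _ _ _ _ ((fun x => f (cinv c x)) \o (fun x => cmap c (cinv c' x)))) => //.
  by move=> _ [q [Uq cq] <-] /=; rewrite cmapK // cmapK //; exact: Uc.
apply: (@C_on_comp _ _ _ _ (cmap c @` U)) => //.
- by move=> _ [q [Uq cq] <-]; rewrite cmapK //; exists q.
- move=> j k'; apply: C_on_sub (atlas_smooth ac' ac j k').
  by move=> _ [q [/Uc Uq cq] <-]; exists q.
Qed.

Lemma smooth_fun_sub U V f : V `<=` U -> smooth_fun U f -> smooth_fun V f.
Proof. by move=> VU [sr si]; split; exact: real_smooth_sub VU _. Qed.

Lemma smooth_fun_local U f :
  (forall p, U p -> exists2 V, V p & smooth_fun V f) -> smooth_fun U f.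
Proof.
move=> H; split; apply: real_smooth_local => p /H [V Vp [sr si]]; by exists V.
Qed.

Lemma smooth_fun_ext U f h : open U -> (forall q, U q -> f q = h q) ->
  smooth_fun U f -> smooth_fun U h.
Proof.
by move=> oU fh [sr si]; split; [apply: real_smooth_ext sr|apply: real_smooth_ext si];
  move=> // q /fh ->.
Qed.

Lemma smooth_fun_cst U a : open U -> smooth_fun U (fun=> a).
Proof. by move=> oU; split; exact: real_smooth_cst. Qed.

Lemma ReD (x y : C) : complex.Re (x + y) = complex.Re x + complex.Re y.
Proof. by case: x; case: y. Qed.
Lemma ImD (x y : C) : complex.Im (x + y) = complex.Im x + complex.Im y.
Proof. by case: x; case: y. Qed.
Lemma ReM (x y : C) :
  complex.Re (x * y) = complex.Re x * complex.Re y - complex.Im x * complex.Im y.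
Proof. by case: x; case: y. Qed.
Lemma ImM (x y : C) :
  complex.Im (x * y) = complex.Re x * complex.Im y + complex.Im x * complex.Re y.
Proof. by case: x => a b; case: y => c d /=; rewrite [LHS]/=; ring. Qed.
Lemma ReJ (x : C) : complex.Re x^* = complex.Re x. Proof. by case: x. Qed.
Lemma ImJ (x : C) : complex.Im x^* = - complex.Im x. Proof. by case: x. Qed.

Lemma smooth_funD U f h : open U -> smooth_fun U f -> smooth_fun U h ->
  smooth_fun U (fun q => f q + h q).
Proof.
move=> oU [fr fi] [hr hi]; split.
  by apply: real_smooth_ext (real_smoothD oU fr hr) => // q _; rewrite ReD.
by apply: real_smooth_ext (real_smoothD oU fi hi) => // q _; rewrite ImD.
Qed.

Lemma smooth_funM U f h : open U -> smooth_fun U f -> smooth_fun U h ->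
  smooth_fun U (fun q => f q * h q).
Proof.
move=> oU [fr fi] [hr hi]; split.
  apply: real_smooth_ext (real_smoothD oU (real_smoothM oU fr hr)
    (real_smoothN oU (real_smoothM oU fi hi))) => // q _; by rewrite ReM.
apply: real_smooth_ext (real_smoothD oU (real_smoothM oU fr hi)
    (real_smoothM oU fi hr)) => // q _; by rewrite ImM.
Qed.

Lemma smooth_funN U f : open U -> smooth_fun U f -> smooth_fun U (fun q => - f q).
Proof.
move=> oU sf; apply: smooth_fun_ext (smooth_funM oU (smooth_fun_cst (-1) oU) sf) => //.
by move=> q _; rewrite mulN1r.
Qed.

Lemma smooth_fun_conj U f : open U -> smooth_fun U f -> smooth_fun U (fun q => (f q)^*).
Proof.
move=> oU [fr fi]; split.
  by apply: real_smooth_ext fr => // q _; rewrite ReJ.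
by apply: real_smooth_ext (real_smoothN oU fi) => // q _; rewrite ImJ.
Qed.

Lemma smooth_funV U f : open U -> (forall q, U q -> f q != 0) ->
  smooth_fun U f -> smooth_fun U (fun q => (f q)^-1).
Proof.
move=> oU f0 [fr fi].
(* 1/f is conj f divided by the squared modulus N, so the real rules apply to both parts. *)
pose N q := complex.Re (f q) * complex.Re (f q) + complex.Im (f q) * complex.Im (f q).
have N0 q : U q -> N q != 0.
  move=> /f0; apply: contraNneq; rewrite /N -!expr2.
  by move=> /eqP; rewrite paddr_eq0 ?sqr_ge0 // !sqrf_eq0 eq_complex.
have sN : real_smooth U (fun q => (N q)^-1).
  apply: real_smoothV => //; apply: real_smoothD => //; exact: real_smoothM.
split.
  apply: real_smooth_ext (real_smoothM oU fr sN) => // q _.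
  by rewrite /N -!expr2; case: (f q).
apply: real_smooth_ext (real_smoothN oU (real_smoothM oU fi sN)) => // q _.
by rewrite /N -!expr2; case: (f q).
Qed.

Lemma smooth_fun_sum U m (F : 'I_m -> M -> C) : open U ->
  (forall j, smooth_fun U (F j)) -> smooth_fun U (fun q => \sum_j F j q).
Proof.
move=> oU sF; have -> : (fun q => \sum_j F j q) = \sum_j F j.
  by rewrite funeqE => x; rewrite fct_sumE.
elim/big_ind: _ => [|f h sf sh|j _]; [exact: smooth_fun_cst|exact: smooth_funD|exact: sF].
Qed.

Lemma toC_mul m k l (A : 'M[R]_(m, k)) (B : 'M[R]_(k, l)) :
  toC (A *m B) = toC A *m toC B.
Proof. exact: (map_mxM (real_complex R)). Qed.

Lemma conjM_mul m k l (A : 'M[C]_(m, k)) (B : 'M[C]_(k, l)) :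
  conjM (A *m B) = conjM A *m conjM B.
Proof.
apply/matrixP => i j; rewrite !mxE rmorph_sum; apply: eq_bigr => l0 _.
by rewrite !mxE rmorphM.
Qed.

Lemma conjM_toC m k (A : 'M[R]_(m, k)) : conjM (toC A) = toC A.
Proof. by apply/matrixP => i j; rewrite !mxE conjc_real. Qed.

Lemma conjMK m k : involutive (@conjM R m k).
Proof. by move=> A; apply/matrixP => i j; rewrite !mxE conjcK. Qed.

Lemma conjMD m k (A B : 'M[C]_(m, k)) : conjM (A + B) = conjM A + conjM B.
Proof. by apply/matrixP => i j; rewrite !mxE rmorphD. Qed.

Lemma conjMB m k (A B : 'M[C]_(m, k)) : conjM (A - B) = conjM A - conjM B.
Proof. by apply/matrixP => i j; rewrite !mxE rmorphB. Qed.

Lemma conjMZ m k a (A : 'M[C]_(m, k)) : conjM (a *: A) = (a^*)%C *: conjM A.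
Proof. by apply/matrixP => i j; rewrite !mxE rmorphM. Qed.

Lemma conjM_submx m k l (A : 'M[C]_(m, l)) (B : 'M[C]_(k, l)) :
  (A <= B)%MS -> (conjM A <= conjM B)%MS.
Proof. by case/submxP => T ->; rewrite conjM_mul submxMl. Qed.

Lemma componentsD c (X Y : M -> 'rV[C]_n) q :
  components c (fun q => X q + Y q) q = components c X q + components c Y q.
Proof. exact: mulmxDl. Qed.

Lemma componentsZ c (f : M -> C) (X : M -> 'rV[C]_n) q :
  components c (fun q => f q *: X q) q = f q *: components c X q.
Proof. by rewrite /components scalemxAl. Qed.

Lemma componentsJ c (X : M -> 'rV[C]_n) q :
  components c (fun q => conjM (X q)) q = conjM (components c X q).
Proof. by rewrite /components conjM_mul conjM_toC. Qed.

Lemma smooth_field_sub U V (X : M -> 'rV[C]_n) :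
  V `<=` U -> smooth_field U X -> smooth_field V X.
Proof.
move=> VU sX c ac i; apply: smooth_fun_sub (sX c ac i).
by move=> q [/VU Uq cq].
Qed.

Lemma smooth_field_local U (X : M -> 'rV[C]_n) :
  (forall p, U p -> exists2 V, V p & smooth_field V X) -> smooth_field U X.
Proof.
move=> H c ac i; apply: smooth_fun_local => p [/H [V Vp sV] cp].
by exists (V `&` cdom c) => //; exact: sV.
Qed.

Lemma smooth_field_ext U (X Y : M -> 'rV[C]_n) : open U ->
  (forall q, U q -> X q = Y q) -> smooth_field U X -> smooth_field U Y.
Proof.
move=> oU XY sX c ac i; apply: smooth_fun_ext (sX c ac i).
  by apply: openI => //; exact: cdom_open.
by move=> q [/XY E _]; rewrite /components E.
Qed.

Lemma smooth_fieldD U (X Y : M -> 'rV[C]_n) : open U ->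
  smooth_field U X -> smooth_field U Y -> smooth_field U (fun q => X q + Y q).
Proof.
move=> oU sX sY c ac i; have oUc : open (U `&` cdom c).
  by apply: openI => //; exact: cdom_open.
apply: smooth_fun_ext (smooth_funD oUc (sX c ac i) (sY c ac i)) => // q _.
by rewrite componentsD [RHS]mxE.
Qed.

Lemma smooth_fieldZ U f (X : M -> 'rV[C]_n) : open U ->
  smooth_fun U f -> smooth_field U X -> smooth_field U (fun q => f q *: X q).
Proof.
move=> oU sf sX c ac i; have oUc : open (U `&` cdom c).
  by apply: openI => //; exact: cdom_open.
have sf' : smooth_fun (U `&` cdom c) f by apply: smooth_fun_sub sf => q [].
apply: smooth_fun_ext (smooth_funM oUc sf' (sX c ac i)) => // q _.
by rewrite componentsZ [RHS]mxE.
Qed.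

Lemma smooth_field_conj U (X : M -> 'rV[C]_n) : open U ->
  smooth_field U X -> smooth_field U (fun q => conjM (X q)).
Proof.
move=> oU sX c ac i; have oUc : open (U `&` cdom c).
  by apply: openI => //; exact: cdom_open.
apply: smooth_fun_ext (smooth_fun_conj oUc (sX c ac i)) => // q _.
by rewrite componentsJ [RHS]mxE.
Qed.

Lemma smooth_field0 U : open U -> smooth_field U (fun=> 0 : 'rV[C]_n).
Proof.
move=> oU c ac i; have oUc : open (U `&` cdom c).
  by apply: openI => //; exact: cdom_open.
apply: smooth_fun_ext (smooth_fun_cst 0 oUc) => // q _.
by rewrite /components mul0mx mxE.
Qed.

Lemma smooth_field_sum U m (X : 'I_m -> M -> 'rV[C]_n) : open U ->
  (forall j, smooth_field U (X j)) -> smooth_field U (fun q => \sum_j X j q).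
Proof.
move=> oU sF; have -> : (fun q => \sum_j X j q) = \sum_j X j.
  by rewrite funeqE => x; rewrite fct_sumE.
elim/big_ind: _ => [|f h sf sh|j _]; [exact: smooth_field0|exact: smooth_fieldD|exact: sF].
Qed.

Definition rpartial c i (f : M -> R) q : R :=
  partial i (fun x => f (cinv c x)) (cmap c q).

Definition cpartial c i (f : M -> C) q : C :=
  rpartial c i (fun q => complex.Re (f q)) q
  +i* rpartial c i (fun q => complex.Im (f q)) q.

Lemma real_smooth_differentiable c U f q : atlas c -> real_smooth U f ->
  U q -> cdom c q -> differentiable (fun x => f (cinv c x)) (cmap c q).
Proof.
move=> ac sf Uq cq; apply: (smooth_on_differentiable (sf c ac)).
by exists q.
Qed.

Lemma eq_rpartial c i f h q : cdom c q -> (\near q, f q = h q) ->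
  rpartial c i f q = rpartial c i h q.
Proof.
move=> cq fh; apply: eq_partial.
by have := near_chart cq fh; apply: filterS => x [].
Qed.

Lemma eq_cpartial c i f h q : cdom c q -> (\near q, f q = h q) ->
  cpartial c i f q = cpartial c i h q.
Proof.
by move=> cq fh; congr (_ +i* _); apply: eq_rpartial => //; apply: filterS fh => x ->.
Qed.

(** The partials are controlled in the chart c alone; [real_smooth_one_chart] carries this to the
    other charts. *)
Lemma smooth_rpartial c i U f : atlas c -> open U -> real_smooth U f ->
  real_smooth (U `&` cdom c) (rpartial c i f).
Proof.
move=> ac oU sf; apply: (real_smooth_one_chart ac).
- by apply: openI => //; exact: cdom_open.
- by move=> q [].
move=> k; apply: C_on_ext (smooth_on_partial i (sf c ac) k).
  exact: chart_image_open.
by move=> _ [q [Uq cq] <-]; rewrite /rpartial cmapK.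
Qed.

Lemma smooth_cpartial c i U f : atlas c -> open U -> smooth_fun U f ->
  smooth_fun (U `&` cdom c) (cpartial c i f).
Proof. by move=> ac oU [fr fi]; split; exact: smooth_rpartial. Qed.

Lemma transition_differentiable c0 c p j : atlas c0 -> atlas c ->
  cdom c0 p -> cdom c p ->
  differentiable (fun x => cmap c (cinv c0 x) 0 j) (cmap c0 p).
Proof.
move=> ac0 ac c0p cp; apply: (smooth_on_differentiable (atlas_smooth ac0 ac j)).
by exists p.
Qed.

(** Near p, f read in c0 is f read in c composed with the transition map, so this is the chain
    rule. *)
Lemma rpartial_chart c0 c i U f p : atlas c0 -> atlas c -> real_smooth U f ->
  U p -> cdom c0 p -> cdom c p ->
  rpartial c0 i f p =
  \sum_j jacobian (fun x => cmap c (cinv c0 x)) (cmap c0 p) i j * rpartial c j f p.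
Proof.
move=> ac0 ac sf Up c0p cp.
have E : \forall x \near cmap c0 p, f (cinv c0 x) =
    ((fun x => f (cinv c x)) \o (fun x => cmap c (cinv c0 x))) x.
  have nc : nbhs p (cdom c) by apply: open_nbhs_nbhs; split=> //; exact: cdom_open.
  have := near_chart c0p nc; apply: filterS => x [cx _ _] /=.
  by rewrite cmapK.
rewrite /rpartial (eq_partial i E) partial_comp.
- apply: eq_bigr => j _; rewrite jacobianE; last first.
    by move=> k; exact: transition_differentiable.
  by rewrite cmapK.
- by move=> k; exact: transition_differentiable.
- by rewrite cmapK //; exact: real_smooth_differentiable sf Up cp.
Qed.

Lemma cpartial_chart c0 c i U f p : atlas c0 -> atlas c -> smooth_fun U f ->
  U p -> cdom c0 p -> cdom c p ->
  cpartial c0 i f p =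
  \sum_j toC (jacobian (fun x => cmap c (cinv c0 x)) (cmap c0 p)) i j * cpartial c j f p.
Proof.
move=> ac0 ac [fr fi] Up c0p cp.
rewrite /cpartial (rpartial_chart i ac0 ac fr Up) // (rpartial_chart i ac0 ac fi Up) //.
apply/eqP; rewrite eq_complex /=; apply/andP; split; apply/eqP.
  rewrite (big_morph _ ReD (erefl _)); apply: eq_bigr => j _.
  by rewrite ReM [toC _ _ _]mxE [X in _ - X]mul0r subr0.
rewrite (big_morph _ ImD (erefl _)); apply: eq_bigr => j _.
by rewrite ImM [toC _ _ _]mxE [X in _ + X]mul0r addr0.
Qed.

Lemma cpartialD c i U f h q : atlas c -> smooth_fun U f -> smooth_fun U h ->
  U q -> cdom c q ->
  cpartial c i (fun q => f q + h q) q = cpartial c i f q + cpartial c i h q.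
Proof.
move=> ac [fr fi] [hr hi] Uq cq.
have d := real_smooth_differentiable ac _ Uq cq.
have pD f1 h1 : real_smooth U f1 -> real_smooth U h1 ->
    partial i (fun x => f1 (cinv c x) + h1 (cinv c x)) (cmap c q) =
    rpartial c i f1 q + rpartial c i h1 q.
  by move=> s1 s2; rewrite partialD //; exact: d.
apply/eqP; rewrite eq_complex ReD ImD; apply/andP; split; apply/eqP.
  rewrite [RHS]/= -(pD _ _ fr hr) /= /rpartial; congr partial.
  by rewrite funeqE => x; exact: ReD.
rewrite [RHS]/= -(pD _ _ fi hi) /= /rpartial; congr partial.
by rewrite funeqE => x; exact: ImD.
Qed.

Lemma cpartialM c i U f h q : atlas c -> smooth_fun U f -> smooth_fun U h ->
  U q -> cdom c q ->
  cpartial c i (fun q => f q * h q) q = f q * cpartial c i h q + h q * cpartial c i f q.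
Proof.
move=> ac [fr fi] [hr hi] Uq cq.
have d := real_smooth_differentiable ac _ Uq cq.
have dM f1 h1 : real_smooth U f1 -> real_smooth U h1 ->
    differentiable (fun x => f1 (cinv c x) * h1 (cinv c x)) (cmap c q).
  by move=> s1 s2; apply: differentiableM; exact: d.
have pM f1 h1 : real_smooth U f1 -> real_smooth U h1 ->
    partial i (fun x => f1 (cinv c x) * h1 (cinv c x)) (cmap c q) =
    f1 q * rpartial c i h1 q + h1 q * rpartial c i f1 q.
  by move=> s1 s2; rewrite partialM ?cmapK //; exact: d.
apply/eqP; rewrite eq_complex ReD ImD !ReM !ImM; apply/andP; split; apply/eqP.
  rewrite [LHS]/= /rpartial.
  have -> : (fun x => complex.Re (f (cinv c x) * h (cinv c x))) = (fun x =>
     complex.Re (f (cinv c x)) * complex.Re (h (cinv c x)) +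
     - (complex.Im (f (cinv c x)) * complex.Im (h (cinv c x)))).
    by rewrite funeqE => x; exact: ReM.
  rewrite partialD; [|exact: (dM _ _ fr hr)|by apply: differentiableN; exact: (dM _ _ fi hi)].
  rewrite partialN; last exact: (dM _ _ fi hi).
  rewrite (pM _ _ fr hr) (pM _ _ fi hi) [complex.Re (cpartial _ _ _ _)]/=.
  by rewrite [complex.Im (cpartial _ _ _ _)]/= [complex.Re (cpartial _ _ _ _)]/=
     [complex.Im (cpartial _ _ _ _)]/=; ring.
rewrite [LHS]/= /rpartial.
have -> : (fun x => complex.Im (f (cinv c x) * h (cinv c x))) = (fun x =>
   complex.Re (f (cinv c x)) * complex.Im (h (cinv c x)) +
   (complex.Im (f (cinv c x)) * complex.Re (h (cinv c x)))).
  by rewrite funeqE => x; exact: ImM.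
rewrite partialD; [|exact: (dM _ _ fr hi)|exact: (dM _ _ fi hr)].
rewrite (pM _ _ fr hi) (pM _ _ fi hr).
by rewrite ![complex.Im (cpartial _ _ _ _)]/= ![complex.Re (cpartial _ _ _ _)]/=; ring.
Qed.

Lemma cpartialJ c i U f q : atlas c -> smooth_fun U f -> U q -> cdom c q ->
  cpartial c i (fun q => (f q)^*) q = (cpartial c i f q)^*.
Proof.
move=> ac [fr fi] Uq cq; have d := real_smooth_differentiable ac fi Uq cq.
rewrite /cpartial /=; congr (_ +i* _).
  by rewrite /rpartial; congr partial; rewrite funeqE => x; rewrite ReJ.
rewrite /rpartial -partialN //; congr partial; rewrite funeqE => x.
by rewrite ImJ.
Qed.

Lemma cpartial_cst c i a q : cpartial c i (fun=> a) q = 0.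
Proof. by rewrite /cpartial /rpartial /= !partial_cst. Qed.

End Smooth.

(** * Directional derivatives, brackets and tensoriality *)

Section Bracket.
Variables (R : realType) (n : nat) (M : manifold R n).
Local Notation C := R[i].
Implicit Types (c : chart R n M) (U V : set M) (p q : M) (v : 'rV[C]_n) (X Y Z : M -> 'rV[C]_n).

Lemma open_near U p : open U -> U p -> nbhs p U.
Proof. by move=> oU Up; apply: open_nbhs_nbhs. Qed.

Lemma near_open p (P : set M) : nbhs p P -> exists V, [/\ open V, V p & V `<=` P].
Proof. by rewrite nbhsE => -[V [oV Vp] VP]; exists V. Qed.

Lemma smooth_fun_near2 p f h : smooth_fun_near p f -> smooth_fun_near p h ->
  exists U, [/\ open U, U p, smooth_fun U f & smooth_fun U h].
Proof.
move=> [U [oU Up sf]] [V [oV Vp sh]]; exists (U `&` V); split.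
- exact: openI.
- by split.
- by apply: smooth_fun_sub sf => q [].
- by apply: smooth_fun_sub sh => q [].
Qed.

Lemma smooth_field_near2 p X Y : smooth_field_near p X -> smooth_field_near p Y ->
  exists U, [/\ open U, U p, smooth_field U X & smooth_field U Y].
Proof.
move=> [U [oU Up sf]] [V [oV Vp sh]]; exists (U `&` V); split.
- exact: openI.
- by split.
- by apply: smooth_field_sub sf => q [].
- by apply: smooth_field_sub sh => q [].
Qed.

Lemma smooth_fun_nearD p f h : smooth_fun_near p f -> smooth_fun_near p h ->
  smooth_fun_near p (fun q => f q + h q).
Proof.
move=> sf sh; have [U [oU Up fU hU]] := smooth_fun_near2 sf sh.
by exists U; split=> //; exact: smooth_funD.
Qed.

Lemma smooth_fun_nearM p f h : smooth_fun_near p f -> smooth_fun_near p h ->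
  smooth_fun_near p (fun q => f q * h q).
Proof.
move=> sf sh; have [U [oU Up fU hU]] := smooth_fun_near2 sf sh.
by exists U; split=> //; exact: smooth_funM.
Qed.

Lemma smooth_fun_near_cst p a : @smooth_fun_near R n M p (fun=> a).
Proof. by exists setT; split=> //; [exact: openT|apply: smooth_fun_cst; exact: openT]. Qed.

Lemma smooth_field_nearD p X Y : smooth_field_near p X -> smooth_field_near p Y ->
  smooth_field_near p (fun q => X q + Y q).
Proof.
move=> sf sh; have [U [oU Up fU hU]] := smooth_field_near2 sf sh.
by exists U; split=> //; exact: smooth_fieldD.
Qed.

Lemma smooth_field_nearZ p f X : smooth_fun_near p f -> smooth_field_near p X ->
  smooth_field_near p (fun q => f q *: X q).
Proof.
move=> [U [oU Up sf]] [V [oV Vp sX]]; have oUV := openI oU oV.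
exists (U `&` V); split=> //; apply: smooth_fieldZ => //.
  by apply: smooth_fun_sub sf => q [].
by apply: smooth_field_sub sX => q [].
Qed.

Lemma smooth_field_near_conj p X : smooth_field_near p X ->
  smooth_field_near p (fun q => conjM (X q)).
Proof. by move=> [U [oU Up sX]]; exists U; split=> //; exact: smooth_field_conj. Qed.

Lemma smooth_field_near0 p : smooth_field_near p (fun=> 0 : 'rV[C]_n).
Proof. by exists setT; split=> //; [exact: openT|apply: smooth_field0; exact: openT]. Qed.

Lemma smooth_field_near_ext p X Y : (\forall q \near p, X q = Y q) ->
  smooth_field_near p X -> smooth_field_near p Y.
Proof.
move=> /near_open[V [oV Vp VE]] [U [oU Up sX]].
exists (U `&` V); split=> //; first exact: openI.
apply: (@smooth_field_ext _ _ _ _ X); first exact: openI.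
  by move=> q [_ /VE].
by apply: smooth_field_sub sX => q [].
Qed.

Lemma dir_derivE p v f : dir_deriv p v f = \sum_i v 0 i * cpartial (chart_at p) i f p.
Proof. by []. Qed.

Lemma dir_deriv_linear p a u v f :
  dir_deriv p (a *: u + v) f = a * dir_deriv p u f + dir_deriv p v f.
Proof.
rewrite !dir_derivE mulr_sumr -big_split; apply: eq_bigr => i _ /=.
by rewrite !mxE mulrDl mulrA.
Qed.

Lemma eq_dir_deriv p v f h : (\forall q \near p, f q = h q) ->
  dir_deriv p v f = dir_deriv p v h.
Proof.
move=> fh; rewrite !dir_derivE; apply: eq_bigr => i _.
by rewrite (eq_cpartial i (chart_at_dom p) fh).
Qed.

Lemma dir_deriv_cst p v a : dir_deriv p v (fun=> a) = 0.
Proof. by rewrite dir_derivE big1 // => i _; rewrite cpartial_cst mulr0. Qed.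

Lemma dir_derivD p v f h : smooth_fun_near p f -> smooth_fun_near p h ->
  dir_deriv p v (fun q => f q + h q) = dir_deriv p v f + dir_deriv p v h.
Proof.
move=> sf sh; have [U [oU Up fU hU]] := smooth_fun_near2 sf sh.
rewrite !dir_derivE -big_split; apply: eq_bigr => i _ /=.
by rewrite (cpartialD i (chart_at_atlas p) fU hU Up (chart_at_dom p)) mulrDr.
Qed.

Lemma dir_derivM p v f h : smooth_fun_near p f -> smooth_fun_near p h ->
  dir_deriv p v (fun q => f q * h q) = f p * dir_deriv p v h + h p * dir_deriv p v f.
Proof.
move=> sf sh; have [U [oU Up fU hU]] := smooth_fun_near2 sf sh.
rewrite !dir_derivE !mulr_sumr -big_split; apply: eq_bigr => i _ /=.
rewrite (cpartialM i (chart_at_atlas p) fU hU Up (chart_at_dom p)) mulrDr.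
by rewrite mulrCA; congr (_ + _); exact: mulrCA.
Qed.

Lemma dir_deriv_sum p v m (F : 'I_m -> M -> C) :
  (forall j, smooth_fun_near p (F j)) ->
  dir_deriv p v (fun q => \sum_j F j q) = \sum_j dir_deriv p v (F j).
Proof.
move=> sF; have -> : (fun q => \sum_j F j q) = \sum_j F j.
  by rewrite funeqE => x; rewrite fct_sumE.
suff [] : smooth_fun_near p (\sum_j F j) /\
  dir_deriv p v (\sum_j F j) = \sum_j dir_deriv p v (F j) by [].
elim/big_rec2: _ => [|j y f _ [sf <-]].
  by split; [exact: smooth_fun_near_cst|exact: dir_deriv_cst].
by split; [exact: smooth_fun_nearD|exact: dir_derivD].
Qed.

Lemma dir_derivJ p v f : smooth_fun_near p f ->
  dir_deriv p (conjM v) (fun q => (f q)^*) = (dir_deriv p v f)^*.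
Proof.
move=> [U [oU Up fU]]; rewrite !dir_derivE rmorph_sum; apply: eq_bigr => i _ /=.
by rewrite (cpartialJ i (chart_at_atlas p) fU Up (chart_at_dom p)) rmorphM !mxE.
Qed.

(** The Jacobian that transforms the components of v is the one by which partials change, so the
    derivative may be computed in any chart around p. *)
Lemma dir_deriv_chart c p v f : atlas c -> cdom c p -> smooth_fun_near p f ->
  dir_deriv p v f =
  \sum_j (v *m toC (jacobian (fun x => cmap c (cinv (chart_at p) x))
            (cmap (chart_at p) p))) 0 j * cpartial c j f p.
Proof.
move=> ac cp [U [oU Up fU]]; rewrite dir_derivE.
under eq_bigr => i _ do rewrite
  (cpartial_chart i (chart_at_atlas p) ac fU Up (chart_at_dom p) cp) mulr_sumr.
rewrite exchange_big; apply: eq_bigr => j _ /=.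
by rewrite [X in _ = X * _]mxE mulr_suml; apply: eq_bigr => i _; rewrite mulrA.
Qed.

(** The definition uses a different chart at each q. Near p everything is rewritten in [chart_at p],
    where the derivative is a sum of products of smooth functions. *)
Lemma smooth_dir_deriv U X f : open U -> smooth_field U X -> smooth_fun U f ->
  smooth_fun U (fun q => dir_deriv q (X q) f).
Proof.
move=> oU sX sf; apply: smooth_fun_local => p Up.
pose c := chart_at p; have ac : atlas c := chart_at_atlas p.
have oV : open (U `&` cdom c) by apply: openI => //; exact: cdom_open.
exists (U `&` cdom c); first by split=> //; exact: chart_at_dom.
apply: (@smooth_fun_ext _ _ _ _ (fun q => \sum_j components c X q 0 j * cpartial c j f q)) => //.
  move=> q [Uq cq]; rewrite (dir_deriv_chart (X q) ac cq) //.
  by exists U.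
apply: smooth_fun_sum => // j; apply: smooth_funM => //; first exact: sX.
exact: smooth_cpartial.
Qed.

Lemma smooth_chart_coord c k : atlas c -> real_smooth (cdom c) (fun q => cmap c q 0 k).
Proof.
by move=> ac c' ac' m; rewrite setIC; exact: (atlas_smooth ac' ac).
Qed.

Lemma jacobian_rpartial c0 c q l k : atlas c0 -> atlas c -> cdom c0 q -> cdom c q ->
  jacobian (fun x => cmap c (cinv c0 x)) (cmap c0 q) l k =
  rpartial c0 l (fun q => cmap c q 0 k) q.
Proof.
move=> ac0 ac c0q cq; rewrite jacobianE // => j.
exact: transition_differentiable.
Qed.

(** Cocycle rule of Jacobians: [rpartial_chart] applied to the coordinate functions of c. *)
Lemma jacobian_chart a c0 c q : atlas a -> atlas c0 -> atlas c ->
  cdom a q -> cdom c0 q -> cdom c q ->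
  jacobian (fun x => cmap c (cinv a x)) (cmap a q) =
  jacobian (fun x => cmap c0 (cinv a x)) (cmap a q) *m
  jacobian (fun x => cmap c (cinv c0 x)) (cmap c0 q).
Proof.
move=> aa ac0 ac aq c0q cq; apply/matrixP => i j.
rewrite jacobian_rpartial // (rpartial_chart i aa ac0 (smooth_chart_coord j ac) cq) //.
rewrite [RHS]mxE; apply: eq_bigr => l _.
by rewrite -(jacobian_rpartial _ _ ac0 ac).
Qed.

Lemma components_chart c0 c X q : atlas c0 -> atlas c -> cdom c0 q -> cdom c q ->
  components c X q =
  components c0 X q *m toC (jacobian (fun x => cmap c (cinv c0 x)) (cmap c0 q)).
Proof.
move=> ac0 ac c0q cq; rewrite /components -mulmxA -toC_mul.
by rewrite -jacobian_chart //; [exact: chart_at_atlas|exact: chart_at_dom].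
Qed.

Lemma components_chart_at p X : components (chart_at p) X p = X p.
Proof.
rewrite /components; set J := jacobian _ _.
suff -> : J = 1%:M.
  have -> : toC (1%:M : 'M[R]_n) = 1%:M by exact: (map_mx1 (real_complex R)).
  by rewrite mulmx1.
have ap := chart_at_atlas p; have dp := chart_at_dom p.
apply/matrixP => i j; rewrite /J jacobian_rpartial // /rpartial.
have E : \forall x \near cmap (chart_at p) p, cmap (chart_at p) (cinv (chart_at p) x) 0 j = x 0 j.
  have := near_chart dp (open_near (@openT M) I).
  by apply: filterS => x [_ _ ->].
by rewrite (eq_partial i E) partial_coord mxE.
Qed.

Lemma rpartial_rpartial c i l U f p : atlas c -> open U -> real_smooth U f ->
  U p -> cdom c p ->
  rpartial c i (rpartial c l f) p = rpartial c l (rpartial c i f) p.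
Proof.
move=> ac oU sf Up cp.
have E k : \forall x \near cmap c p,
    rpartial c k f (cinv c x) = partial k (fun x => f (cinv c x)) x.
  have := near_chart cp (open_near (@openT M) I).
  by apply: filterS => x [_ _]; rewrite /rpartial => ->.
rewrite /rpartial -/(rpartial c l f) -/(rpartial c i f).
rewrite (eq_partial i (E l)) (eq_partial l (E i)).
apply: (@partial_partial _ _ _ _ (cmap c @` (U `&` cdom c))).
- exact: chart_image_open.
- by exists p.
- exact: sf.
Qed.

(** The flat connection of the preferred chart, at p. It serves as a reference derivation: the
    bracket is its antisymmetrization. *)
Definition der p v Y : 'rV[C]_n :=
  \row_k dir_deriv p v (fun q => components (chart_at p) Y q 0 k).

Lemma der_coord p v Y k :
  der p v Y 0 k = dir_deriv p v (fun q => components (chart_at p) Y q 0 k).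
Proof. by rewrite [LHS]mxE. Qed.

Lemma bracketE X Y p : bracket X Y p = der p (X p) Y - der p (Y p) X.
Proof.
by apply/rowP => k; rewrite [LHS]mxE [RHS]mxE der_coord [X in _ = _ + X]mxE der_coord.
Qed.

Lemma bracketN X Y p : bracket X Y p = - bracket Y X p.
Proof. by rewrite (bracketE X Y) (bracketE Y X) opprB. Qed.

Lemma smooth_components p c X k : atlas c -> cdom c p -> smooth_field_near p X ->
  smooth_fun_near p (fun q => components c X q 0 k).
Proof.
move=> ac cp [U [oU Up sX]]; exists (U `&` cdom c); split=> //.
  by apply: openI => //; exact: cdom_open.
exact: sX.
Qed.

(** Passing to the chart c adds to each directional derivative a term with the Hessian of a
    coordinate of c; the Hessian is symmetric, so these terms cancel in the bracket. This makes the
    bracket smooth although its definition uses a chart that depends on the point. *)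
Lemma components_bracket c p X Y : atlas c -> cdom c p ->
  smooth_field_near p X -> smooth_field_near p Y ->
  components c (bracket X Y) p =
  \row_k (dir_deriv p (X p) (fun q => components c Y q 0 k)
        - dir_deriv p (Y p) (fun q => components c X q 0 k)).
Proof.
move=> ac cp sX sY; pose c0 := chart_at p.
have ac0 : atlas c0 := chart_at_atlas p; have c0p : cdom c0 p := chart_at_dom p.
apply/rowP => k; rewrite [RHS]mxE.
pose phi q := cmap c q 0 k; have sphi := smooth_chart_coord k ac : real_smooth _ phi.
have oc := cdom_open c.
(* Column k of the Jacobian from c0 to c, as functions near p; H below holds their derivatives, the
   Hessian of phi. *)
pose t l q : C := (rpartial c0 l phi q)%:C.
have st l : smooth_fun_near p (t l).
  exists (cdom c `&` cdom c0); split=> //; first by apply: openI => //; exact: cdom_open.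
  split; first exact: smooth_rpartial.
  by apply: real_smooth_cst; apply: openI => //; exact: cdom_open.
pose H i l : C := (rpartial c0 i (rpartial c0 l phi) p)%:C.
have HC i l : H i l = H l i by rewrite /H (rpartial_rpartial i l ac0 oc sphi).
have dt v l : dir_deriv p v (t l) = \sum_i v 0 i * H i l.
  rewrite dir_derivE; apply: eq_bigr => i _; congr (_ * _).
  rewrite /cpartial /H /=; apply/eqP; rewrite eq_complex /= eqxx /=.
  by rewrite /rpartial partial_cst.
have dc v Z : smooth_field_near p Z ->
    dir_deriv p v (fun q => components c Z q 0 k) =
    \sum_l (Z p 0 l * (\sum_i v 0 i * H i l) + t l p * der p v Z 0 l).
  move=> sZ; have E : \forall q \near p,
      components c Z q 0 k = \sum_l components c0 Z q 0 l * t l q.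
    have := open_near (openI (cdom_open c) (cdom_open c0)) (conj cp c0p).
    apply: filterS => q [cq c0q].
    rewrite (components_chart Z ac0 ac c0q cq).
    rewrite [LHS]mxE.
    apply: eq_bigr => l _.
    rewrite [toC _ _ _]mxE.
    by rewrite (jacobian_rpartial l k ac0 ac c0q cq).
  have sZl l : smooth_fun_near p (fun q => components c0 Z q 0 l).
    exact: smooth_components.
  rewrite (eq_dir_deriv v E) dir_deriv_sum; last by move=> l; exact: smooth_fun_nearM.
  apply: eq_bigr => l _; rewrite dir_derivM // dt components_chart_at.
  by rewrite [der _ _ _ _ _]mxE.
rewrite (dc _ _ sX) (dc _ _ sY) 
  (_ : components c (bracket X Y) p = bracket X Y p *m
     toC (jacobian (fun x => cmap c (cinv c0 x)) (cmap c0 p))) //.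
rewrite [LHS]mxE bracketE.
have S : \sum_l X p 0 l * (\sum_i Y p 0 i * H i l) = \sum_l Y p 0 l * (\sum_i X p 0 i * H i l).
  under eq_bigr => l _ do rewrite mulr_sumr.
  rewrite exchange_big; apply: eq_bigr => i _; rewrite mulr_sumr.
  by apply: eq_bigr => l _; rewrite HC mulrCA.
rewrite [X in _ = X - _]big_split [X in _ = _ - X]big_split.
have cancel (a b d e : C) : a = d -> a + b - (d + e) = b - e.
  by move=> ->; rewrite opprD addrACA subrr add0r.
rewrite [RHS](cancel _ _ _ _ (esym S)) -sumrB; apply: eq_bigr => l _.
have -> : toC (jacobian (fun x => cmap c (cinv c0 x)) (cmap c0 p)) l k = t l p.
  by rewrite [LHS]mxE (jacobian_rpartial l k ac0 ac c0p cp).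
by rewrite mulrC [X in _ * X]mxE [X in _ * (_ + X)]mxE mulrBr.
Qed.

Lemma smooth_bracket U X Y : open U -> smooth_field U X -> smooth_field U Y ->
  smooth_field U (bracket X Y).
Proof.
move=> oU sX sY c ac k; have oV : open (U `&` cdom c).
  by apply: openI => //; exact: cdom_open.
have sXV : smooth_field (U `&` cdom c) X by apply: smooth_field_sub sX => q [].
have sYV : smooth_field (U `&` cdom c) Y by apply: smooth_field_sub sY => q [].
apply: (@smooth_fun_ext _ _ _ _ (fun q => dir_deriv q (X q) (fun q => components c Y q 0 k)
        - dir_deriv q (Y q) (fun q => components c X q 0 k))) => //.
  move=> q [Uq cq]; rewrite components_bracket //; first by rewrite mxE.
    by exists U.
  by exists U.
apply: smooth_funD => //; last apply: smooth_funN => //.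
  by apply: smooth_dir_deriv => //; exact: sY.
by apply: smooth_dir_deriv => //; exact: sX.
Qed.

(** The axioms of a connection at the single point p. Operators built from local frames, global
    connections and their conjugates all satisfy them, so they can be compared at p. *)
Record derivation_at p (D : 'rV[C]_n -> (M -> 'rV[C]_n) -> 'rV[C]_n) : Prop := DerivationAt {
  derivation_linear : forall (a : C) u v Y, smooth_field_near p Y ->
    D (a *: u + v) Y = a *: D u Y + D v Y;
  derivation_add : forall v Y Z, smooth_field_near p Y -> smooth_field_near p Z ->
    D v (fun q => Y q + Z q) = D v Y + D v Z;
  derivation_leibniz : forall v f Y, smooth_fun_near p f -> smooth_field_near p Y ->
    D v (fun q => f q *: Y q) = dir_deriv p v f *: Y p + f p *: D v Y }.

Lemma derivation_der p : derivation_at p (der p).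
Proof.
have ap := chart_at_atlas p; have dp := chart_at_dom p.
split=> [a u v Y _|v Y Z sY sZ|v f Y sf sY]; apply/rowP => k;
  rewrite der_coord [RHS]mxE [X in _ = X + _]mxE ?der_coord.
- exact: dir_deriv_linear.
- rewrite -dir_derivD; [|exact: smooth_components|exact: smooth_components].
  by apply: eq_dir_deriv; apply: nearW => q; rewrite componentsD [LHS]mxE.
- have E : \forall q \near p, components (chart_at p) (fun q => f q *: Y q) q 0 k =
      f q * components (chart_at p) Y q 0 k.
    by apply: nearW => q; rewrite componentsZ [LHS]mxE.
  rewrite (eq_dir_deriv v E) dir_derivM //; last exact: smooth_components.
  by rewrite components_chart_at addrC mulrC [X in _ = _ + X]mxE der_coord.
Qed.

Lemma derJ p v Y : smooth_field_near p Y ->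
  der p (conjM v) (fun q => conjM (Y q)) = conjM (der p v Y).
Proof.
move=> sY; apply/rowP => k; rewrite der_coord [RHS]mxE der_coord -dir_derivJ; last first.
  by apply: smooth_components => //; [exact: chart_at_atlas|exact: chart_at_dom].
by apply: eq_dir_deriv; apply: nearW => q; rewrite componentsJ [LHS]mxE.
Qed.

Lemma bracketJ p X Y : smooth_field_near p X -> smooth_field_near p Y ->
  bracket (fun q => conjM (X q)) (fun q => conjM (Y q)) p = conjM (bracket X Y p).
Proof. by move=> sX sY; rewrite !bracketE !derJ // conjMB. Qed.

(** * Operators linear over germs of functions *)

Section Tensorial.
Variables (p : M) (W : lmodType C).

Record tensorial_at (T : (M -> 'rV[C]_n) -> W) : Prop := TensorialAt {
  tensorial_add : forall Y Z, smooth_field_near p Y -> smooth_field_near p Z ->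
    T (fun q => Y q + Z q) = T Y + T Z;
  tensorial_scale : forall f Y, smooth_fun_near p f -> smooth_field_near p Y ->
    T (fun q => f q *: Y q) = f p *: T Y }.

Variable T : (M -> 'rV[C]_n) -> W.
Hypothesis tT : tensorial_at T.

Lemma tensorial_sum m (y : 'I_m -> M -> C) (E : 'I_m -> M -> 'rV[C]_n) :
  (forall a, smooth_fun_near p (y a)) -> (forall a, smooth_field_near p (E a)) ->
  T (fun q => \sum_a y a q *: E a q) = \sum_a y a p *: T (E a).
Proof.
move=> sy sE; have -> : (fun q => \sum_a y a q *: E a q) = \sum_a (fun q => y a q *: E a q).
  by rewrite funeqE => x; rewrite fct_sumE.
suff [] : smooth_field_near p (\sum_a (fun q => y a q *: E a q)) /\
  T (\sum_a (fun q => y a q *: E a q)) = \sum_a y a p *: T (E a) by [].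
elim/big_rec2: _ => [|a w Y _ [sY <-]].
  split; first exact: smooth_field_near0.
  (* T 0 = 0 comes from linearity over functions: the zero field is the function 0 times the field
     0. *)
  have -> : (0 : M -> 'rV[C]_n) = (fun q => (0 : C) *: (0 : 'rV[C]_n)).
    by rewrite funeqE => q; rewrite scale0r.
  rewrite (tensorial_scale tT (smooth_fun_near_cst p 0) (smooth_field_near0 p)).
  by rewrite scale0r.
have syE : smooth_field_near p (fun q => y a q *: E a q) by exact: smooth_field_nearZ.
split; first exact: smooth_field_nearD.
by rewrite -(tensorial_scale tT (sy a) (sE a)) -(tensorial_add tT syE sY).
Qed.

(* The difference of two fields with the same germ at p equals its product with a
   function that vanishes near p; no cut-off function is needed because functions
   only have to be smooth near p. *)
Lemma tensorial_ext Y Z : smooth_field_near p Y -> (\forall q \near p, Y q = Z q) ->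
  T Y = T Z.
Proof.
move=> sY YZ; have sZ := smooth_field_near_ext YZ sY.
have sN : smooth_field_near p (fun q => (-1 : C) *: Y q).
  by apply: smooth_field_nearZ => //; exact: smooth_fun_near_cst.
have sZY := smooth_field_nearD sZ sN.
pose f q : C := (Y q != Z q)%:R.
have f0 : \forall q \near p, (0 : C) = f q by apply: filterS YZ => q E; rewrite /f E eqxx.
have sf : smooth_fun_near p f.
  have [V [oV Vp VE]] := near_open f0; exists V; split=> //.
  by apply: smooth_fun_ext (smooth_fun_cst 0 oV).
have -> : Z = (fun q => Y q + f q *: (Z q + (-1) *: Y q)).
  rewrite funeqE => q; rewrite /f; have [->|_] := eqVneq (Y q) (Z q).
    by rewrite scale0r addr0.
  by rewrite scale1r scaleN1r addrCA subrr addr0.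
rewrite (tensorial_add tT sY (smooth_field_nearZ sf sZY)).
by rewrite (tensorial_scale tT sf sZY) -(nbhs_singleton f0) scale0r addr0.
Qed.

End Tensorial.

(** The derivative of f is the same in both Leibniz rules and cancels. *)
Lemma tensorial_diff p D D' v : derivation_at p D -> derivation_at p D' ->
  tensorial_at p (fun Y => D v Y - D' v Y).
Proof.
move=> dD dD'; split=> [Y Z sY sZ|f Y sf sY].
  by rewrite (derivation_add dD v sY sZ) (derivation_add dD' v sY sZ) opprD addrACA.
rewrite (derivation_leibniz dD v sf sY) (derivation_leibniz dD' v sf sY).
by rewrite opprD addrACA subrr add0r scalerBr.
Qed.

End Bracket.

(** * Bilinear forms and the coefficients of the Weyl connection *)

Section Forms.
Variables (R : realType) (n : nat).
Local Notation C := R[i].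
Implicit Types (A : 'M[R]_n) (u v w : 'rV[C]_n) (a : C).

Lemma innerDl A u v w : inner A (u + v) w = inner A u w + inner A v w.
Proof. by rewrite /inner !mulmxDl mxE. Qed.

Lemma innerZl A a u w : inner A (a *: u) w = a * inner A u w.
Proof. by rewrite /inner -!scalemxAl mxE. Qed.

Lemma inner_sym A u v : A^T = A -> inner A u v = inner A v u.
Proof.
move=> sA; rewrite /inner.
transitivity ((u *m toC A *m v^T)^T 0 0); first by rewrite [RHS]mxE.
have tA : (toC A)^T = toC A.
  by apply/matrixP => i j; rewrite !mxE -[in LHS]sA mxE.
by rewrite !trmx_mul trmxK mulmxA tA.
Qed.

Lemma innerDr A u v w : inner A w (u + v) = inner A w u + inner A w v.
Proof. by rewrite /inner linearD mulmxDr mxE. Qed.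

Lemma innerZr A a u w : inner A w (a *: u) = a * inner A w u.
Proof. by rewrite /inner linearZ -scalemxAr mxE. Qed.

Lemma inner0l A w : inner A 0 w = 0.
Proof. by rewrite /inner !mul0mx mxE. Qed.

Lemma inner_suml A m (F : 'I_m -> 'rV[C]_n) w :
  inner A (\sum_j F j) w = \sum_j inner A (F j) w.
Proof.
apply: (big_morph (fun u => inner A u w)); last exact: inner0l.
by move=> u v; exact: innerDl.
Qed.

Lemma innerBl A u v w : inner A (u - v) w = inner A u w - inner A v w.
Proof. by rewrite -scaleN1r innerDl innerZl mulN1r. Qed.

Lemma innerJ A u v : inner A (conjM u) (conjM v) = (inner A u v)^*.
Proof.
have trJ : (conjM v)^T = conjM v^T by apply/matrixP => i j; rewrite !mxE.
by rewrite /inner trJ -{1}(conjM_toC A) -!conjM_mul [LHS]mxE.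
Qed.

Lemma pairingDr u v w : pairing w (u + v) = pairing w u + pairing w v.
Proof.
by rewrite -big_split; apply: eq_bigr => i _ /=; rewrite mxE mulrDr.
Qed.

Lemma pairingZr a u w : pairing w (a *: u) = a * pairing w u.
Proof.
by rewrite /pairing mulr_sumr; apply: eq_bigr => i _; rewrite mxE mulrCA.
Qed.

Lemma pairing_sumr m (F : 'I_m -> 'rV[C]_n) w :
  pairing w (\sum_j F j) = \sum_j pairing w (F j).
Proof.
apply: (big_morph (fun u => pairing w u)); first by move=> u v; exact: pairingDr.
by rewrite /pairing big1 // => i _; rewrite mxE mulr0.
Qed.

Lemma pairingDl u v w : pairing (u + v) w = pairing u w + pairing v w.
Proof.
by rewrite -big_split; apply: eq_bigr => i _ /=; rewrite mxE mulrDl.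
Qed.

Lemma pairingZl a u w : pairing (a *: u) w = a * pairing u w.
Proof.
by rewrite /pairing mulr_sumr; apply: eq_bigr => i _; rewrite mxE mulrA.
Qed.

Lemma pairing_suml m (F : 'I_m -> 'rV[C]_n) w :
  pairing (\sum_j F j) w = \sum_j pairing (F j) w.
Proof.
apply: (big_morph (fun u => pairing u w)); first by move=> u v; exact: pairingDl.
by rewrite /pairing big1 // => i _; rewrite mxE mul0r.
Qed.

Lemma pairing_delta w i : pairing w (delta_mx 0 i) = w 0 i.
Proof.
rewrite /pairing (bigD1 i) //= mxE !eqxx mulr1 big1 ?addr0 // => j ji.
by rewrite mxE (negPf ji) andbF mulr0.
Qed.

Lemma pairing_inj u v : (forall w, pairing u w = pairing v w) -> u = v.
Proof. by move=> H; apply/rowP => i; rewrite -!pairing_delta. Qed.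

Lemma pairingJ u w : pairing (conjM u) (conjM w) = (pairing u w)^*.
Proof.
by rewrite /pairing rmorph_sum; apply: eq_bigr => i _; rewrite !mxE rmorphM.
Qed.

(** [u *m toC A] is the covector obtained from u by lowering its index. *)
Lemma pairing_inner A u v : pairing (u *m toC A) v = inner A u v.
Proof. by rewrite /inner [RHS]mxE; apply: eq_bigr => i _; rewrite [v^T _ _]mxE. Qed.

End Forms.

Lemma ord4P (P : 'I_4 -> Prop) : P i1 -> P i2 -> P i3 -> P i4 -> forall a, P a.
Proof.
move=> P1 P2 P3 P4 [[|[|[|[|//]]]] h].
- by rewrite (_ : Ordinal h = i1) //; exact: val_inj.
- by rewrite (_ : Ordinal h = i2) //; exact: val_inj.
- by rewrite (_ : Ordinal h = i3) //; exact: val_inj.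
- by rewrite (_ : Ordinal h = i4) //; exact: val_inj.
Qed.

Lemma sum4 (V : nmodType) (F : 'I_4 -> V) :
  \sum_a F a = F i1 + F i2 + F i3 + F i4.
Proof.
rewrite !big_ord_recr big_ord0 /= add0r.
by congr (F _ + F _ + F _ + F _); exact: val_inj.
Qed.

(** The only nonzero Gram entries are g12, g34 and their transposes, so lowering an index in a null
    frame is this swap. *)
Definition dual_index (a : 'I_4) : 'I_4 :=
  match val a with 0 => i2 | 1 => i1 | 2 => i4 | _ => i3 end%N.

Lemma dual_indexK : involutive dual_index.
Proof. by move=> a; elim/ord4P: a. Qed.

(** * Algebra of connection coefficients in a null frame *)

Section Coefficients.
Variable F : numFieldType.

Definition eta (a b : 'I_4) : F := (b == dual_index a)%:R.

Lemma eta_sym a b : eta a b = eta b a.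
Proof. by rewrite /eta -(can_eq dual_indexK) dual_indexK eq_sym. Qed.

Lemma etaE : ((eta i1 i1 = 0) * (eta i1 i2 = 1) * (eta i1 i3 = 0) * (eta i1 i4 = 0)
  * (eta i2 i1 = 1) * (eta i2 i2 = 0) * (eta i2 i3 = 0) * (eta i2 i4 = 0)
  * (eta i3 i1 = 0) * (eta i3 i2 = 0) * (eta i3 i3 = 0) * (eta i3 i4 = 1)
  * (eta i4 i1 = 0) * (eta i4 i2 = 0) * (eta i4 i3 = 1) * (eta i4 i4 = 0))%type.
Proof. by []. Qed.

Lemma two_neq0 : (2 : F) != 0. Proof. by rewrite pnatr_eq0. Qed.

(* The Christoffel trick: the two symmetries of A determine it. *)
Lemma weyl_coefficients (A : 'I_4 -> 'I_4 -> 'I_4 -> F) (beta : 'I_4 -> F) :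
  (forall a b c, A a b c = A a c b) ->
  (forall a b c, A a b c + A b a c = eta a b * beta c) ->
  forall a b c, A a b c =
    2^-1 * (eta c a * beta b - eta c b * beta a + eta a b * beta c).
Proof.
move=> sA mA a b c; apply: (mulfI two_neq0); rewrite mulVKf ?two_neq0 //.
rewrite (eta_sym c b) -(mA a b c) -(mA b c a) -(mA c a b).
by rewrite (sA b a c) (sA c b a) (sA a c b); ring.
Qed.

Variable K : 'I_4 -> 'I_4 -> 'I_4 -> F.
Hypothesis KA : forall a b c, K a b c = - K b a c.

(** K a b c stands for g([e_a, e_b], e_c). In a frame with constant Gram matrix the Koszul formula
    has only bracket terms, and this is the Levi-Civita coefficient (a,b,c). *)
Definition koszul a b c : F := 2^-1 * (K c b a - K c a b - K b a c).

(* Half of B(e_a). *)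
Definition lee_coef (a : 'I_4) : F := match val a with
  | 0 => koszul i1 i4 i3 | 1 => koszul i2 i3 i4
  | 2 => koszul i3 i2 i1 | _ => koszul i4 i1 i2 end%N.

(** The formula of the theorem; the factor 1/2 is absorbed in [lee_coef]. *)
Definition weyl_coef a b c : F :=
  koszul a b c + (eta c a * lee_coef b - eta c b * lee_coef a + eta a b * lee_coef c).

Lemma koszulA a b c : koszul a b c + koszul b a c = 0.
Proof. by rewrite /koszul (KA a b c); ring. Qed.

Lemma koszul_torsion a b c : koszul a b c - koszul a c b = K c b a.
Proof.
rewrite /koszul (KA b c a) -mulrBr; apply: (mulfI two_neq0).
by rewrite mulVKf ?two_neq0 //; ring.
Qed.

Lemma weyl_coef_metric a b c : weyl_coef a b c + weyl_coef b a c = eta a b * (2 * lee_coef c).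
Proof.
by rewrite /weyl_coef addrACA koszulA (eta_sym b a); ring.
Qed.

Lemma weyl_coef_torsion a b c : weyl_coef a b c - weyl_coef a c b = K c b a.
Proof.
rewrite -(koszul_torsion a b c) /weyl_coef (eta_sym c b) (eta_sym a c) (eta_sym b a).
by ring.
Qed.

Lemma Kaa a c : K a a c = 0.
Proof.
by apply/eqP; rewrite -[_ == 0](mulrI_eq0 _ (mulfI two_neq0)) mulr_natl mulr2n
  {1}KA addNr.
Qed.

Lemma weyl_coef_aa a c : weyl_coef a a c = eta a a * lee_coef c.
Proof. by rewrite /weyl_coef /koszul Kaa; ring. Qed.

(** Involutivity in coefficients: [e1, e4] is orthogonal to e1 and e4, hence in N, and [e2, e3] to
    e2 and e3, hence in conj N. *)
Hypotheses (K141 : K i1 i4 i1 = 0) (K144 : K i1 i4 i4 = 0)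
  (K232 : K i2 i3 i2 = 0) (K233 : K i2 i3 i3 = 0).

(** For c = 2 and c = 3 the form cancels [koszul], which is how [lee_coef] was chosen; for c = 1 and
    c = 4 every [eta] vanishes and [koszul] equals [K i1 i4 c]. *)
Lemma weyl_coef14 c : weyl_coef i1 i4 c = 0.
Proof.
elim/ord4P: c; rewrite /weyl_coef !etaE /lee_coef /=.
- by rewrite /koszul Kaa (KA i4 i1) K141; ring.
- by have := koszulA i1 i4 i2 => /eqP; rewrite addr_eq0 => /eqP ->; ring.
- by ring.
- by rewrite /koszul Kaa (KA i4 i1) K144; ring.
Qed.

Lemma weyl_coef23 c : weyl_coef i2 i3 c = 0.
Proof.
elim/ord4P: c; rewrite /weyl_coef !etaE /lee_coef /=.
- by have := koszulA i2 i3 i1 => /eqP; rewrite addr_eq0 => /eqP ->; ring.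
- by rewrite /koszul Kaa (KA i3 i2) K232; ring.
- by rewrite /koszul Kaa (KA i3 i2) K233; ring.
- by ring.
Qed.

Lemma weyl_coef41 c : weyl_coef i4 i1 c = 0.
Proof. by have := weyl_coef_metric i1 i4 c; rewrite weyl_coef14 etaE add0r mul0r. Qed.

Lemma weyl_coef32 c : weyl_coef i3 i2 c = 0.
Proof. by have := weyl_coef_metric i2 i3 c; rewrite weyl_coef23 etaE add0r mul0r. Qed.

End Coefficients.

(** * Null frames and pointwise uniqueness *)

Lemma sumrD (V : nmodType) (I : finType) (F G : I -> V) :
  \sum_i (F i + G i) = \sum_i F i + \sum_i G i.
Proof. exact: big_split. Qed.

Section Expand.
Variables (R : realType).
Local Notation C := R[i].
Local Notation eta := (eta R[i]).

(** H is its own inverse, so A P^T H is a right inverse of the square matrix P, hence also a left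
    inverse, and u is u (A P^T H) P. *)
Lemma gram_expand (A : 'M[R]_4) (E : 'I_4 -> 'rV[C]_4) (u : 'rV[C]_4) :
  (forall a b, inner A (E a) (E b) = eta a b) ->
  u = \sum_a inner A u (E (dual_index a)) *: E a.
Proof.
move=> gE; pose P : 'M[C]_4 := \matrix_a E a.
pose H : 'M[C]_4 := \matrix_(a, b) eta a b.
have entry (w : 'rV[C]_4) b : (w *m toC A *m P^T) 0 b = inner A w (E b).
  rewrite /inner [LHS]mxE [RHS]mxE; apply: eq_bigr => i _; congr (_ * _).
  by rewrite [LHS]mxE [LHS]mxE [RHS]mxE.
have PH : P *m toC A *m P^T = H.
  apply/matrixP => a b; rewrite [RHS]mxE -gE -entry.
  have -> : E a = row a P by rewrite rowK.
  by rewrite -!row_mul [RHS]mxE.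
have HH : H *m H = 1%:M.
  apply/matrixP => a b; rewrite [LHS]mxE [RHS]mxE sum4.
  have HE i j : H i j = eta i j by rewrite mxE.
  rewrite !HE.
  by elim/ord4P: a; elim/ord4P: b; rewrite !etaE ?(mulr0, mul0r, addr0, add0r, mulr1).
have QP : (toC A *m P^T *m H) *m P = 1%:M.
  by apply: mulmx1C; rewrite mulmxA mulmxA PH HH.
rewrite -[LHS]mulmx1 -QP mulmxA mulmx_sum_row; apply: eq_bigr => a _.
have HE i j : H i j = eta i j by rewrite mxE.
rewrite rowK; congr (_ *: _); rewrite mulmxA mulmxA [LHS]mxE sum4 !entry !HE.
by elim/ord4P: a; rewrite !etaE ?(mulr0, mul0r, addr0, add0r, mulr1).
Qed.

Lemma linear_sumZ (n : nat) (W : lmodType C) (L : 'rV[C]_n -> W) m (x : 'I_m -> C) w :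
  (forall (a : C) u v, L (a *: u + v) = a *: L u + L v) ->
  L (\sum_c x c *: w c) = \sum_c x c *: L (w c).
Proof.
move=> lL; have L0 : L 0 = 0.
  by have /eqP := lL 1 0 0; rewrite !scale1r addr0 -subr_eq0 opprD addrA subrr sub0r
    oppr_eq0 => /eqP.
by elim/big_rec2: _ => [//|c y u _ <-]; rewrite lL.
Qed.

(** A null plane spanned by half of a null frame is its own orthogonal: the coefficient of u along
    [E (dual_index k)] is its product with [E k], so orthogonality to [E k] and [E l] leaves only
    multiples of these two. Membership in N thus becomes two scalar equations. *)
Lemma lagrangian (A : 'M[R]_4) (E : 'I_4 -> 'rV[C]_4) (N : 'M[C]_4) k l (u : 'rV[C]_4) :
  (forall a b, inner A (E a) (E b) = eta a b) ->
  [set: 'I_4] = [set k; l; dual_index k; dual_index l] ->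
  (E k <= N)%MS -> (E l <= N)%MS ->
  (forall u v : 'rV[C]_4, (u <= N)%MS -> (v <= N)%MS -> inner A u v = 0) ->
  (u <= N)%MS <-> inner A u (E k) = 0 /\ inner A u (E l) = 0.
Proof.
move=> gE kl kN lN nN; split=> [uN|[uk ul]]; first by split; apply: nN.
rewrite (gram_expand u gE); apply: summx_sub => a _.
have : [set: 'I_4] a by [].
rewrite kl => -[[[->|->]|->]|->]; [exact: scalemx_sub|exact: scalemx_sub|..];
  by rewrite dual_indexK ?uk ?ul scale0r sub0mx.
Qed.

End Expand.

Section WeylAt.
Variables (R : realType) (M : manifold R 4) (g : metric M).
Local Notation C := R[i].
Local Notation eta := (eta R[i]).
Implicit Types (U V : set M) (p q : M) (v : 'rV[C]_4) (X Y Z : M -> 'rV[C]_4)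
  (E : 'I_4 -> M -> 'rV[C]_4) (D : 'rV[C]_4 -> (M -> 'rV[C]_4) -> 'rV[C]_4).

Record gram_frame U E : Prop := GramFrame {
  gram_frame_smooth : forall a, smooth_field U (E a);
  gram_frameE : forall q, U q -> forall a b, inner (g q) (E a q) (E b q) = eta a b }.

(** The covector b is complex, because an operator made from a local frame is not known to be real.
    The Levi-Civita connection is the case b = 0. *)
Record weyl_metric_at p D (b : 'rV[C]_4) : Prop := WeylMetricAt {
  weyl_derivation : derivation_at p D;
  weyl_torsion : forall X Y, smooth_field_near p X -> smooth_field_near p Y ->
    D (X p) Y - D (Y p) X = bracket X Y p;
  weyl_metric : forall v X Y, smooth_field_near p X -> smooth_field_near p Y ->
    dir_deriv p v (fun q => inner (g q) (X q) (Y q))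
    - inner (g p) (D v X) (Y p) - inner (g p) (X p) (D v Y)
    = - (pairing b v * inner (g p) (X p) (Y p)) }.

(** Unlike in [preserves], the direction v is complex. *)
Definition preserves_at p D (L : M -> 'M[C]_4) : Prop :=
  forall v U Y, open U -> U p -> section_of L U Y -> (D v Y <= L p)%MS.

Lemma smooth_inner_near p X Y : smooth_field_near p X -> smooth_field_near p Y ->
  smooth_fun_near p (fun q => inner (g q) (X q) (Y q)).
Proof.
move=> sX sY; have [U [oU Up fU hU]] := smooth_field_near2 sX sY.
by exists U; split=> //; exact: gram_smooth.
Qed.

Section Frame.
Variables (U : set M) (E : 'I_4 -> M -> 'rV[C]_4) (p : M).
Hypotheses (oU : open U) (Up : U p) (gE : gram_frame U E).

Definition frame_coef a q (u : 'rV[C]_4) : C := inner (g q) u (E (dual_index a) q).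

Lemma frame_near a : smooth_field_near p (E a).
Proof. by exists U; split=> //; exact: gram_frame_smooth. Qed.

Lemma frame_coord q u : U q -> u = \sum_a frame_coef a q u *: E a q.
Proof. by move=> Uq; exact: (gram_expand u (gram_frameE gE Uq)). Qed.

Lemma coord_linear a q (x : C) u w : frame_coef a q (x *: u + w) = x * frame_coef a q u + frame_coef a q w.
Proof. by rewrite /frame_coef innerDl innerZl. Qed.

Lemma coord_smooth a Y : smooth_field_near p Y -> smooth_fun_near p (fun q => frame_coef a q (Y q)).
Proof. by move=> sY; apply: smooth_inner_near => //; exact: frame_near. Qed.

Lemma tensorial_frame (W : lmodType C) (T : (M -> 'rV[C]_4) -> W) Y :
  tensorial_at p T -> smooth_field_near p Y ->
  T Y = \sum_a frame_coef a p (Y p) *: T (E a).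
Proof.
move=> tT sY; rewrite -(tensorial_sum tT (fun a => coord_smooth a sY) frame_near).
apply: (tensorial_ext tT sY); apply: filterS (open_near oU Up) => q Uq.
exact: frame_coord.
Qed.

Lemma linear_frame (W : lmodType C) (L : 'rV[C]_4 -> W) v :
  (forall (a : C) u v, L (a *: u + v) = a *: L u + L v) ->
  L v = \sum_c frame_coef c p v *: L (E c p).
Proof. by move=> lL; rewrite {1}(frame_coord v Up) linear_sumZ. Qed.

Definition gamma D a b c : C := inner (g p) (D (E c p) (E b)) (E a p).

(** The difference of two derivations is tensorial in Y and linear in v, so its values on the frame
    determine it. *)
Lemma gamma_eq D D' v Y : derivation_at p D -> derivation_at p D' ->
  (forall a b c, gamma D a b c = gamma D' a b c) -> smooth_field_near p Y ->
  D v Y = D' v Y.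
Proof.
move=> dD dD' eD sY; apply/eqP; rewrite -subr_eq0; apply/eqP.
rewrite (tensorial_frame (tensorial_diff v dD dD') sY) big1 // => b _.
have sb := frame_near b.
rewrite (_ : _ - _ = 0) ?scaler0 //.
rewrite (linear_frame (L := fun v => D v (E b) - D' v (E b)) v); last first.
  move=> x u w; rewrite (derivation_linear dD _ _ _ sb) (derivation_linear dD' _ _ _ sb).
  by rewrite opprD addrACA scalerBr.
rewrite big1 // => c _; rewrite (_ : _ - _ = 0) ?scaler0 //.
apply/eqP; rewrite subr_eq0 (frame_coord (D _ _) Up) (frame_coord (D' _ _) Up).
by apply/eqP; apply: eq_bigr => a _; rewrite /frame_coef -!/(gamma _ _ _ _) eD.
Qed.

(** The Gram entries are constant near p, so their derivative drops out of the Weyl condition. *)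
Lemma frame_metric D b i j c : weyl_metric_at p D b ->
  gamma D i j c + gamma D j i c = eta i j * pairing b (E c p).
Proof.
move=> wD; have := weyl_metric wD (E c p) (frame_near i) (frame_near j).
have nE : \forall q \near p, inner (g q) (E i q) (E j q) = eta i j.
  by apply: filterS (open_near oU Up) => q Uq; exact: (gram_frameE gE Uq).
rewrite (eq_dir_deriv _ nE) dir_deriv_cst (nbhs_singleton nE) sub0r.
rewrite (inner_sym (E i p)) ?gram_sym // -/(gamma D j i c) -/(gamma D i j c).
by rewrite -opprD => /oppr_inj; rewrite addrC mulrC.
Qed.

Lemma frame_torsion D b i j c : weyl_metric_at p D b ->
  gamma D i j c - gamma D i c j = inner (g p) (bracket (E c) (E j) p) (E i p).
Proof.
move=> wD; rewrite -(weyl_torsion wD (frame_near c) (frame_near j)).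
by rewrite innerBl.
Qed.

(** Equal torsions make the difference symmetric in j and c; the Weyl conditions give its
    symmetrization in i and j; [weyl_coefficients] does the rest. For D' Levi-Civita and b' = 0 this
    is the formula of the theorem for the Weyl coefficients. *)
Lemma frame_diff D D' b b' i j c : weyl_metric_at p D b -> weyl_metric_at p D' b' ->
  gamma D i j c - gamma D' i j c =
  2^-1 * (eta c i * (pairing b (E j p) - pairing b' (E j p))
        - eta c j * (pairing b (E i p) - pairing b' (E i p))
        + eta i j * (pairing b (E c p) - pairing b' (E c p))).
Proof.
move=> wD wD'.
apply: (weyl_coefficients (A := fun i j c => gamma D i j c - gamma D' i j c)
  (beta := fun c => pairing b (E c p) - pairing b' (E c p))) => k l m.
  have e : gamma D k l m - gamma D k m l = gamma D' k l m - gamma D' k m l.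
    by rewrite (frame_torsion _ _ _ wD) (frame_torsion _ _ _ wD').
  have -> : gamma D k l m = gamma D' k l m - gamma D' k m l + gamma D k m l.
    by rewrite -e subrK.
  by ring.
rewrite addrACA -opprD (frame_metric _ _ _ wD) (frame_metric _ _ _ wD').
by rewrite mulrBr.
Qed.

Lemma pairing_frame b v : pairing b v = \sum_c frame_coef c p v * pairing b (E c p).
Proof.
rewrite {1}(frame_coord v Up) pairing_sumr; apply: eq_bigr => c _.
exact: pairingZr.
Qed.

End Frame.

(** N and conj N are described by orthogonality, not by spans: in this form preservation becomes the
    vanishing of coefficients. *)
Record null_frame (N : M -> 'M[C]_4) U E : Prop := NullFrame {
  null_frame_gram : gram_frame U E;
  null_frameN : forall q, U q -> forall u : 'rV[C]_4,
    (u <= N q)%MS <-> inner (g q) u (E i1 q) = 0 /\ inner (g q) u (E i4 q) = 0;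
  null_frameJ : forall q, U q -> forall u : 'rV[C]_4,
    (u <= conjM (N q))%MS <-> inner (g q) u (E i2 q) = 0 /\ inner (g q) u (E i3 q) = 0 }.

Lemma null_frameP (N : M -> 'M[C]_4) U E : null_plane_field g N ->
  (forall a, smooth_field U (E a)) ->
  (forall q, U q -> forall a b, inner (g q) (E a q) (E b q) = eta a b) ->
  (forall q, U q -> (E i1 q <= N q)%MS /\ (E i4 q <= N q)%MS) ->
  (forall q, U q -> (E i2 q <= conjM (N q))%MS /\ (E i3 q <= conjM (N q))%MS) ->
  null_frame N U E.
Proof.
move=> [_ nN] sE gE EN EJ; split=> [//|q Uq u|q Uq u].
  have [N1 N4] := EN q Uq.
  apply: (lagrangian u (gE q Uq) _ N1 N4); last exact: nN.
  by apply/seteqP; split=> // a _; elim/ord4P: a; [left; left; left|left; right|right|left; left; right].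
have [J2 J3] := EJ q Uq.
apply: (lagrangian u (gE q Uq) _ J2 J3).
  by apply/seteqP; split=> // a _; elim/ord4P: a; [left; right|left; left; left|left; left; right|right].
move=> v w vJ wJ; have cN x : (x <= conjM (N q))%MS -> (conjM x <= N q)%MS.
  by move=> xJ; rewrite -[N q]conjMK; exact: conjM_submx.
by rewrite -[v]conjMK -[w]conjMK innerJ nN ?conjc0 //; exact: cN.
Qed.

Record weyl_at (N : M -> 'M[C]_4) p D (b : 'rV[C]_4) : Prop := WeylAt {
  weyl_at_metric : weyl_metric_at p D b;
  weyl_atN : preserves_at p D N;
  weyl_atJ : preserves_at p D (fun q => conjM (N q)) }.

(** * Uniqueness at a point *)

Section Unique.
Variables (N : M -> 'M[C]_4) (U : set M) (E : 'I_4 -> M -> 'rV[C]_4) (p : M).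
Hypotheses (oU : open U) (Up : U p) (nE : null_frame N U E).
Let gE := null_frame_gram nE.

Lemma frame_sectionN a : a = i1 \/ a = i4 -> section_of N U (E a).
Proof.
move=> a14; split; first exact: (gram_frame_smooth gE).
move=> q Uq; apply/(null_frameN nE Uq).
by case: a14 => ->; rewrite !(gram_frameE gE Uq) !etaE.
Qed.

Lemma frame_sectionJ a : a = i2 \/ a = i3 -> section_of (fun q => conjM (N q)) U (E a).
Proof.
move=> a14; split; first exact: (gram_frame_smooth gE).
move=> q Uq; apply/(null_frameJ nE Uq).
by case: a14 => ->; rewrite !(gram_frameE gE Uq) !etaE.
Qed.

Lemma gamma_nullN D a b c : preserves_at p D N -> a = i1 \/ a = i4 -> b = i1 \/ b = i4 ->
  gamma E p D a b c = 0.
Proof.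
move=> pD a14 b14.
have /(null_frameN nE Up)[D1 D4] := pD (E c p) U (E b) oU Up (frame_sectionN b14).
by case: a14 => ->.
Qed.

Lemma gamma_nullJ D a b c : preserves_at p D (fun q => conjM (N q)) ->
  a = i2 \/ a = i3 -> b = i2 \/ b = i3 -> gamma E p D a b c = 0.
Proof.
move=> pD a14 b14.
have /(null_frameJ nE Up)[D1 D4] := pD (E c p) U (E b) oU Up (frame_sectionJ b14).
by case: a14 => ->.
Qed.

(** Serves twice. With D' Levi-Civita and b' = 0 it is the formula for B; with D' a second Weyl
    operator the right sides vanish and give b = b'. *)
Lemma weyl_at_form D D' b b' : weyl_at N p D b -> weyl_metric_at p D' b' ->
  let delta a := pairing b (E a p) - pairing b' (E a p) in
  let G := gamma E p D' in
  [/\ 2^-1 * delta i1 = G i1 i4 i3, 2^-1 * delta i2 = G i2 i3 i4,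
      2^-1 * delta i3 = G i3 i2 i1 & 2^-1 * delta i4 = G i4 i1 i2].
Proof.
move=> [wD pN pJ] wD' delta G.
(* Positions where g_ci = g_ij = 0 and g_cj = 1: of the three terms of [frame_diff] only that of
   [delta i] survives. *)
have form i j c : gamma E p D i j c = 0 -> eta c i = 0 -> eta c j = 1 -> eta i j = 0 ->
    2^-1 * delta i = G i j c.
  move=> G0 ci cj ij; have := frame_diff oU Up gE i j c wD wD'.
  rewrite G0 ci cj ij mul0r mul1r mul0r addr0 !sub0r mulrN => /oppr_inj /esym.
  exact.
split; apply: form; rewrite ?etaE //.
- by apply: gamma_nullN => //; [left|right].
- by apply: gamma_nullJ => //; [left|right].
- by apply: gamma_nullJ => //; [right|left].
- by apply: gamma_nullN => //; [right|left].
Qed.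

Lemma weyl_at_unique D D' b b' : weyl_at N p D b -> weyl_at N p D' b' ->
  b = b' /\ (forall v Y, smooth_field_near p Y -> D v Y = D' v Y).
Proof.
move=> wD wD'; have [w' pN' pJ'] := wD'; have [w _ _] := wD.
have [d1 d2 d3 d4] := weyl_at_form wD w'.
have two0 : (2^-1 : C) != 0 by rewrite invr_eq0 two_neq0.
have d a : pairing b (E a p) - pairing b' (E a p) = 0.
  apply: (mulfI two0); rewrite mulr0; elim/ord4P: a.
  - by rewrite d1; apply: gamma_nullN => //; [left|right].
  - by rewrite d2; apply: gamma_nullJ => //; [left|right].
  - by rewrite d3; apply: gamma_nullJ => //; [right|left].
  - by rewrite d4; apply: gamma_nullN => //; [right|left].
split.
  apply: pairing_inj => v; rewrite (pairing_frame Up gE b) (pairing_frame Up gE b').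
  by apply: eq_bigr => c _; congr (_ * _); apply/eqP; rewrite -subr_eq0 d.
move=> v Y sY; apply: (gamma_eq oU Up gE) => //; first exact: weyl_derivation w.
  exact: weyl_derivation w'.
move=> i j c; apply/eqP; rewrite -subr_eq0 (frame_diff oU Up gE i j c w w').
by rewrite !d !mulr0 subr0 addr0 mulr0.
Qed.

End Unique.

(** * The operator defined by a local frame *)

Section Exists.
Variables (U : set M) (E : 'I_4 -> M -> 'rV[C]_4).
Hypotheses (oU : open U) (gE : gram_frame U E).

Definition structure_coef q a b c : C := inner (g q) (bracket (E a) (E b) q) (E c q).

(** In components, v(Y^a) + Gamma^a_bc Y^b v^c; the upper index a is the lower index
    [dual_index a]. *)
Definition frame_weyl q v Y : 'rV[C]_4 :=
  \sum_a (dir_deriv q v (fun r => frame_coef E a r (Y r))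
    + \sum_b \sum_c frame_coef E b q (Y q) * frame_coef E c q v
        * weyl_coef (structure_coef q) (dual_index a) b c) *: E a q.

(** The covector [E (dual_index a) q *m toC (g q)] is the coframe element theta^a, so this is the
    form B with B(e_a) as coefficients. *)
Definition frame_form q : 'rV[C]_4 :=
  \sum_a (2 * lee_coef (structure_coef q) a) *: (E (dual_index a) q *m toC (g q)).

Lemma structure_coefA q a b c : structure_coef q a b c = - structure_coef q b a c.
Proof.
by rewrite /structure_coef (bracketN (E a) (E b)) -scaleN1r innerZl mulN1r.
Qed.

Lemma coord_frame q a b : U q -> frame_coef E a q (E b q) = (a == b)%:R.
Proof.
move=> Uq; rewrite /frame_coef (gram_frameE gE Uq).
by rewrite /eta (can_eq dual_indexK).
Qed.

Lemma derivation_frame_weyl q : U q -> derivation_at q (frame_weyl q).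
Proof.
move=> Uq; have sc a := coord_smooth oU Uq gE a.
split=> [x u v Y sY|v Y Z sY sZ|v f Y sf sY].
- rewrite /frame_weyl scaler_sumr -sumrD; apply: eq_bigr => a _.
  rewrite dir_deriv_linear scalerA -scalerDl; congr (_ *: _).
  rewrite mulrDr addrACA; congr (_ + _); rewrite mulr_sumr -sumrD.
  apply: eq_bigr => b _; rewrite mulr_sumr -sumrD; apply: eq_bigr => c _.
  by rewrite coord_linear /=; ring.
- rewrite /frame_weyl -sumrD; apply: eq_bigr => a _.
  rewrite -scalerDl; congr (_ *: _).
  have -> : dir_deriv q v (fun r => frame_coef E a r (Y r + Z r)) =
      dir_deriv q v (fun r => frame_coef E a r (Y r)) + dir_deriv q v (fun r => frame_coef E a r (Z r)).
    rewrite -(dir_derivD v (sc a Y sY) (sc a Z sZ)); apply: eq_dir_deriv.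
    by apply: nearW => r; rewrite /frame_coef innerDl.
  rewrite addrACA; congr (_ + _); rewrite -sumrD.
  apply: eq_bigr => b _; rewrite -sumrD; apply: eq_bigr => c _.
  by rewrite /frame_coef innerDl /=; ring.
- rewrite /frame_weyl scaler_sumr {2}(frame_coord gE (Y q) Uq) scaler_sumr -sumrD.
  apply: eq_bigr => a _.
  rewrite !scalerA -scalerDl; congr (_ *: _).
  have -> : dir_deriv q v (fun r => frame_coef E a r (f r *: Y r)) =
      dir_deriv q v f * frame_coef E a q (Y q) + f q * dir_deriv q v (fun r => frame_coef E a r (Y r)).
    rewrite addrC (mulrC (dir_deriv q v f)) -(dir_derivM v sf (sc a Y sY)).
    by apply: eq_dir_deriv; apply: nearW => r; rewrite /frame_coef innerZl.
  rewrite mulrDr -addrA; congr (_ + (_ + _)); rewrite mulr_sumr.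
  apply: eq_bigr => b _; rewrite mulr_sumr; apply: eq_bigr => c _.
  by rewrite /frame_coef innerZl; ring.
Qed.

End Exists.
End WeylAt.

(** * The Weyl connection of a null frame *)

Section TensorialOperators.
Variables (R : realType) (n : nat) (M : manifold R n) (p : M) (W : lmodType R[i]).

Lemma tensorialB (T T' : (M -> 'rV[R[i]]_n) -> W) : tensorial_at p T -> tensorial_at p T' ->
  tensorial_at p (fun Y => T Y - T' Y).
Proof.
move=> tT tT'; split=> [Y Z sY sZ|f Y sf sY].
  by rewrite (tensorial_add tT sY sZ) (tensorial_add tT' sY sZ) opprD addrACA.
by rewrite (tensorial_scale tT sf sY) (tensorial_scale tT' sf sY) scalerBr.
Qed.

Lemma tensorial_linear (L : 'rV[R[i]]_n -> W) :
  (forall (a : R[i]) u v, L (a *: u + v) = a *: L u + L v) ->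
  tensorial_at p (fun Y => L (Y p)).
Proof.
move=> lL; have L0 : L 0 = 0.
  by have := linear_sumZ (m := 0) (fun=> 0) (fun=> 0) lL; rewrite !big_ord0.
split=> [Y Z _ _|f Y _ _]; first by have := lL 1 (Y p) (Z p); rewrite !scale1r.
by have := lL (f p) (Y p) 0; rewrite L0 !addr0.
Qed.

End TensorialOperators.

Section FrameWeyl.
Variables (R : realType) (M : manifold R 4) (g : metric M).
Local Notation C := R[i].
Local Notation eta := (eta R[i]).
Variables (U : set M) (E : 'I_4 -> M -> 'rV[C]_4).
Hypotheses (oU : open U) (gE : gram_frame g U E).
Implicit Types (V : set M) (p q : M) (v : 'rV[C]_4) (X Y Z : M -> 'rV[C]_4)
  (D : 'rV[C]_4 -> (M -> 'rV[C]_4) -> 'rV[C]_4).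
Local Notation structure_coef := (structure_coef g E).
Local Notation frame_weyl := (frame_weyl g E).
Local Notation frame_form := (frame_form g E).
Local Notation frame_coef := (frame_coef g E).

Lemma frame_weylE q v b : U q ->
  frame_weyl q v (E b) =
  \sum_a (\sum_c frame_coef c q v * weyl_coef (structure_coef q) (dual_index a) b c) *: E a q.
Proof.
move=> Uq; apply: eq_bigr => a _; congr (_ *: _).
have nE : \forall r \near q, frame_coef a r (E b r) = (a == b)%:R.
  by apply: filterS (open_near oU Uq) => r Ur; exact: (coord_frame gE).
rewrite (eq_dir_deriv v nE) dir_deriv_cst add0r (bigD1 b) //=.
rewrite [X in _ + X]big1 ?addr0 => [|d db].
  by apply: eq_bigr => c _; rewrite (coord_frame gE _ _ Uq) eqxx mul1r.
by apply: big1 => c _; rewrite (coord_frame gE _ _ Uq) (negPf db) !mul0r.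
Qed.

Lemma inner_frame_weyl q v a b : U q ->
  inner (g q) (frame_weyl q v (E b)) (E a q) =
  \sum_c frame_coef c q v * weyl_coef (structure_coef q) a b c.
Proof.
move=> Uq; rewrite frame_weylE // inner_suml (bigD1 (dual_index a)) //=.
rewrite innerZl (gram_frameE gE Uq) /eta dual_indexK eqxx mulr1.
rewrite [X in _ + X]big1 ?addr0 // => d da.
rewrite innerZl (gram_frameE gE Uq) /eta.
by rewrite -(can_eq dual_indexK) dual_indexK eq_sym (negPf da) mulr0.
Qed.

Lemma gamma_frame_weyl q a b c : U q ->
  gamma g E q (frame_weyl q) a b c = weyl_coef (structure_coef q) a b c.
Proof.
move=> Uq; rewrite /gamma inner_frame_weyl // (bigD1 c) //=.
rewrite (coord_frame gE _ _ Uq) eqxx mul1r [X in _ + X]big1 ?addr0 // => d dc.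
by rewrite (coord_frame gE _ _ Uq) (negPf dc) mul0r.
Qed.

Lemma pairing_frame_form q v :
  pairing (frame_form q) v = \sum_a frame_coef a q v * (2 * lee_coef (structure_coef q) a).
Proof.
rewrite pairing_suml; apply: eq_bigr => a _.
rewrite pairingZl pairing_inner mulrC; congr (_ * _).
by rewrite inner_sym ?gram_sym.
Qed.

Lemma torsion_tensorial q X : U q -> smooth_field_near q X ->
  tensorial_at q (fun Y => frame_weyl q (X q) Y - frame_weyl q (Y q) X - bracket X Y q).
Proof.
move=> Uq sX; have dD := derivation_frame_weyl oU gE Uq.
have dd := derivation_der q.
(* Adding and subtracting [der] splits the torsion into a difference of derivations, tensorial in Y,
   and a term that depends on Y only through its value at q. *)
have -> : (fun Y => frame_weyl q (X q) Y - frame_weyl q (Y q) X - bracket X Y q) =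
    (fun Y => (frame_weyl q (X q) Y - der q (X q) Y) - (frame_weyl q (Y q) X - der q (Y q) X)).
  rewrite funeqE => Y; rewrite bracketE !opprB addrACA [RHS]addrACA; congr (_ + _).
  exact: addrC.
apply: tensorialB; first exact: tensorial_diff.
apply: (@tensorial_linear _ _ _ _ _ (fun u => frame_weyl q u X - der q u X)) => x u w.
rewrite (derivation_linear dD x u w sX) (derivation_linear dd x u w sX).
by rewrite opprD addrACA scalerBr.
Qed.

(** The defect is tensorial, so it suffices to check it on the frame; antisymmetry carries
    tensoriality from the second argument to the first. *)
Lemma torsion_frame_weyl q X Y : U q -> smooth_field_near q X -> smooth_field_near q Y ->
  frame_weyl q (X q) Y - frame_weyl q (Y q) X = bracket X Y q.
Proof.
move=> Uq sX sY.
pose T X Y := frame_weyl q (X q) Y - frame_weyl q (Y q) X - bracket X Y q.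
have TN Z W : T Z W = - T W Z.
  by rewrite /T opprD opprB (bracketN W Z) opprK.
have tT Z (sZ : smooth_field_near q Z) : tensorial_at q (T Z) by exact: torsion_tensorial.
have sE := frame_near oU Uq gE.
have TE a b : T (E a) (E b) = 0.
  rewrite (frame_coord gE (T _ _) Uq) big1 // => c _.
  have -> : frame_coef c q (T (E a) (E b)) =
      weyl_coef (structure_coef q) (dual_index c) b a
      - weyl_coef (structure_coef q) (dual_index c) a b
      - structure_coef q a b (dual_index c).
    transitivity (inner (g q) (frame_weyl q (E a q) (E b)) (E (dual_index c) q)
      - inner (g q) (frame_weyl q (E b q) (E a)) (E (dual_index c) q)
      - structure_coef q a b (dual_index c)); first by rewrite [LHS]innerBl innerBl.
    exact: (congr2 (fun x y => x - y - structure_coef q a b (dual_index c))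
      (gamma_frame_weyl _ b a Uq) (gamma_frame_weyl _ a b Uq)).
  by rewrite (weyl_coef_torsion (structure_coefA g E q)) subrr scale0r.
have TEY a : T (E a) Y = 0.
  rewrite (tensorial_frame oU Uq gE (tT _ (sE a)) sY) big1 // => b _.
  by rewrite TE scaler0.
have : T X Y = 0.
  rewrite TN (tensorial_frame oU Uq gE (tT _ sY) sX) big1 ?oppr0 // => a _.
  by rewrite TN TEY oppr0 scaler0.
by move=> /eqP; rewrite subr_eq0 => /eqP.
Qed.

(** The Leibniz term from differentiating the inner product cancels that of D. [C^o] views the
    scalars as a module over themselves. *)
Lemma metric_tensorial D q (beta : C) v X : derivation_at q D -> smooth_field_near q X ->
  @tensorial_at R 4 M q C^o
   (fun Y => dir_deriv q v (fun r => inner (g r) (X r) (Y r))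
    - inner (g q) (D v X) (Y q) - inner (g q) (X q) (D v Y)
    + beta * inner (g q) (X q) (Y q)).
Proof.
move=> dD sX; split=> [Y Z sY sZ|f Y sf sY].
  rewrite (derivation_add dD v sY sZ) !innerDr.
  have -> : dir_deriv q v (fun r => inner (g r) (X r) (Y r + Z r)) =
      dir_deriv q v (fun r => inner (g r) (X r) (Y r))
      + dir_deriv q v (fun r => inner (g r) (X r) (Z r)).
    rewrite -dir_derivD; [|exact: smooth_inner_near|exact: smooth_inner_near].
    by apply: eq_dir_deriv; apply: nearW => r; rewrite innerDr.
  rewrite -[RHS]/(GRing.add _ _); set a1 := dir_deriv _ _ _; set a2 := dir_deriv _ _ _.
  by ring.
rewrite (derivation_leibniz dD v sf sY) !innerDr !innerZr.
have -> : dir_deriv q v (fun r => inner (g r) (X r) (f r *: Y r)) =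
    f q * dir_deriv q v (fun r => inner (g r) (X r) (Y r))
    + inner (g q) (X q) (Y q) * dir_deriv q v f.
  rewrite -dir_derivM //; last exact: smooth_inner_near.
  by apply: eq_dir_deriv; apply: nearW => r; rewrite innerZr.
set a1 := dir_deriv _ _ _; set a2 := dir_deriv _ _ _.
rewrite [RHS]mulrDr.
by ring.
Qed.

(** As for the torsion, with symmetry in place of antisymmetry. *)
Lemma metric_frame_weyl q v X Y : U q -> smooth_field_near q X -> smooth_field_near q Y ->
  dir_deriv q v (fun r => inner (g r) (X r) (Y r))
    - inner (g q) (frame_weyl q v X) (Y q) - inner (g q) (X q) (frame_weyl q v Y)
    = - (pairing (frame_form q) v * inner (g q) (X q) (Y q)).
Proof.
move=> Uq sX sY; have dD := derivation_frame_weyl oU gE Uq.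
pose T X Y : C^o := dir_deriv q v (fun r => inner (g r) (X r) (Y r))
    - inner (g q) (frame_weyl q v X) (Y q) - inner (g q) (X q) (frame_weyl q v Y)
    + pairing (frame_form q) v * inner (g q) (X q) (Y q).
have TC Z W : T Z W = T W Z.
  have s u w : inner (g q) u w = inner (g q) w u by apply: inner_sym; exact: gram_sym.
  have e : dir_deriv q v (fun r => inner (g r) (Z r) (W r)) =
      dir_deriv q v (fun r => inner (g r) (W r) (Z r)).
    by apply: eq_dir_deriv; apply: nearW => r; apply: inner_sym; exact: gram_sym.
  apply: (congr2 (fun x y => x + pairing (frame_form q) v * y)); last exact: s.
  rewrite addrAC; apply: congr2; last by rewrite s.
  by apply: congr2; [exact: e|rewrite s].
have tT Z (sZ : smooth_field_near q Z) : tensorial_at q (T Z) by exact: metric_tensorial.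
have sE := frame_near oU Uq gE.
have TE a b : T (E a) (E b) = 0.
  have e1 := inner_frame_weyl v b a Uq; have e2 := inner_frame_weyl v a b Uq.
  rewrite inner_sym in e2; last exact: gram_sym.
  have nE : \forall r \near q, inner (g r) (E a r) (E b r) = eta a b.
    by apply: filterS (open_near oU Uq) => r Ur; exact: (gram_frameE gE Ur).
  have e0 : dir_deriv q v (fun r => inner (g r) (E a r) (E b r)) = 0.
    by rewrite (eq_dir_deriv v nE) dir_deriv_cst.
  transitivity (0 - \sum_c frame_coef c q v * weyl_coef (structure_coef q) b a c
     - \sum_c frame_coef c q v * weyl_coef (structure_coef q) a b c
     + pairing (frame_form q) v * eta a b).
    exact: (congr2 (fun x y => x + pairing (frame_form q) v * y)
      (congr2 (fun x y => x - y) (congr2 (fun x y => x - y) e0 e1) e2) (gram_frameE gE Uq a b)).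
  rewrite sub0r -opprD -sumrD pairing_frame_form mulr_suml.
  apply/eqP; rewrite addrC subr_eq0; apply/eqP; apply: eq_bigr => c _.
  by rewrite -mulrDr (weyl_coef_metric (structure_coefA g E q) b a c) (eta_sym _ b a); ring.
have TEY a : T (E a) Y = 0.
  rewrite (tensorial_frame oU Uq gE (tT _ (sE a)) sY) big1 // => b _.
  by rewrite TE scaler0.
have : T X Y = 0.
  rewrite TC (tensorial_frame oU Uq gE (tT _ sY) sX) big1 // => a _.
  by rewrite TC TEY scaler0.
by move=> /eqP; rewrite addr_eq0 => /eqP.
Qed.

Lemma weyl_metric_frame_weyl q : U q -> weyl_metric_at g q (frame_weyl q) (frame_form q).
Proof.
move=> Uq; split; first exact: (derivation_frame_weyl oU gE Uq).
  by move=> X Y sX sY; exact: torsion_frame_weyl.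
by move=> v X Y sX sY; exact: metric_frame_weyl.
Qed.

End FrameWeyl.

(** * Preserved plane fields and smoothness of the operator *)

Section Preserve.
Variables (R : realType) (M : manifold R 4) (g : metric M).
Local Notation C := R[i].
Local Notation eta := (eta R[i]).
Variables (U : set M) (E : 'I_4 -> M -> 'rV[C]_4).
Hypotheses (oU : open U) (gE : gram_frame g U E).
Implicit Types (V : set M) (p q : M) (v : 'rV[C]_4) (X Y Z : M -> 'rV[C]_4)
  (D : 'rV[C]_4 -> (M -> 'rV[C]_4) -> 'rV[C]_4).
Local Notation structure_coef := (structure_coef g E).
Local Notation frame_weyl := (frame_weyl g E).
Local Notation frame_form := (frame_form g E).
Local Notation frame_coef := (frame_coef g E).

(** A section Y of L is not expanded in the frame: g(Y, e_m) is identically 0 for m = k, l, so the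
    Weyl condition gives g(D_v Y, e_m) = - g(Y, D_v e_m), and this is 0 because D_v e_m lies in the
    null plane L. *)
Lemma preserves_gamma q D beta (L : M -> 'M[C]_4) k l : U q -> weyl_metric_at g q D beta ->
  (forall r, U r -> forall u : 'rV[C]_4,
    (u <= L r)%MS <-> inner (g r) u (E k r) = 0 /\ inner (g r) u (E l r) = 0) ->
  (forall u w : 'rV[C]_4, (u <= L q)%MS -> (w <= L q)%MS -> inner (g q) u w = 0) ->
  (forall a b c, a = k \/ a = l -> b = k \/ b = l -> gamma g E q D a b c = 0) ->
  preserves_at q D L.
Proof.
move=> Uq wD cL nL g0; have dD := weyl_derivation wD.
have sE := frame_near oU Uq gE.
have DE v m : m = k \/ m = l -> (D v (E m) <= L q)%MS.
  move=> km; apply/(cL q Uq).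
  have z m' : m' = k \/ m' = l -> inner (g q) (D v (E m)) (E m' q) = 0.
    move=> km'; have lin (a : C) u w : inner (g q) (D (a *: u + w) (E m)) (E m' q) =
        a * inner (g q) (D u (E m)) (E m' q) + inner (g q) (D w (E m)) (E m' q).
      by rewrite (derivation_linear dD a u w (sE m)) innerDl innerZl.
    have -> := @linear_frame _ _ g U E q Uq gE C^o
      (fun v => inner (g q) (D v (E m)) (E m' q)) v lin.
    apply: big1 => c _; have := g0 m' m c km' km; rewrite /gamma => ->.
    exact: scaler0.
  by split; apply: z; [left|right].
move=> v V Y oV Vq [sY YL]; apply/(cL q Uq).
have z m : m = k \/ m = l -> inner (g q) (D v Y) (E m q) = 0.
  move=> km; have sYn : smooth_field_near q Y by exists V.
  have i0 : \forall r \near q, inner (g r) (Y r) (E m r) = 0.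
    apply: filterS (open_near (openI oV oU) (conj Vq Uq)) => r [Vr Ur].
    by have /(cL r Ur)[ik il] := YL r Vr; case: km => ->.
  have := weyl_metric wD v sYn (sE m).
  rewrite (eq_dir_deriv v i0) dir_deriv_cst (nbhs_singleton i0) mulr0.
  rewrite (nL (Y q) (D v (E m)) (YL q Vq) (DE v m km)) subr0 sub0r oppr0.
  by move=> /eqP; rewrite oppr_eq0 => /eqP.
by split; apply: z; [left|right].
Qed.

Lemma smooth_structure_coef a b c : smooth_fun U (fun q => structure_coef q a b c).
Proof.
have sE := gram_frame_smooth gE.
by apply: gram_smooth => //; exact: smooth_bracket.
Qed.

Lemma smooth_koszul a b c : smooth_fun U (fun q => koszul (structure_coef q) a b c).
Proof.
apply: (smooth_funM oU (smooth_fun_cst _ oU)).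
apply: (smooth_funD oU); last exact: (smooth_funN oU (smooth_structure_coef _ _ _)).
apply: (smooth_funD oU); last exact: (smooth_funN oU (smooth_structure_coef _ _ _)).
exact: smooth_structure_coef.
Qed.

Lemma smooth_lee_coef a : smooth_fun U (fun q => lee_coef (structure_coef q) a).
Proof. by elim/ord4P: a; exact: smooth_koszul. Qed.

Lemma smooth_weyl_coef a b c : smooth_fun U (fun q => weyl_coef (structure_coef q) a b c).
Proof.
have sl x y d : smooth_fun U (fun q => eta x y * lee_coef (structure_coef q) d).
  exact: (smooth_funM oU (smooth_fun_cst _ oU) (smooth_lee_coef d)).
apply: (smooth_funD oU (smooth_koszul a b c)).
apply: (smooth_funD oU); last exact: sl.
by apply: (smooth_funD oU); [exact: sl|apply: (smooth_funN oU); exact: sl].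
Qed.

Lemma smooth_frame_coef V X a : open V -> V `<=` U -> smooth_field V X ->
  smooth_fun V (fun q => frame_coef a q (X q)).
Proof.
move=> oV VU sX; apply: (gram_smooth g oV sX).
exact: smooth_field_sub VU (gram_frame_smooth gE _).
Qed.

Lemma smooth_frame_weyl V X Y : open V -> V `<=` U -> smooth_field V X -> smooth_field V Y ->
  smooth_field V (fun q => frame_weyl q (X q) Y).
Proof.
move=> oV VU sX sY; apply: (smooth_field_sum oV) => a.
apply: (smooth_fieldZ oV); last exact: smooth_field_sub VU (gram_frame_smooth gE _).
apply: (smooth_funD oV).
  by apply: (smooth_dir_deriv oV sX); exact: smooth_frame_coef.
apply: (smooth_fun_sum oV) => b; apply: (smooth_fun_sum oV) => c.
apply: (smooth_funM oV); last exact: smooth_fun_sub VU (smooth_weyl_coef _ _ _).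
by apply: (smooth_funM oV); exact: smooth_frame_coef.
Qed.

Lemma smooth_frame_form V X : open V -> V `<=` U -> smooth_field V X ->
  smooth_fun V (fun q => pairing (frame_form q) (X q)).
Proof.
move=> oV VU sX.
apply: (@smooth_fun_ext _ _ _ _ (fun q => \sum_a frame_coef a q (X q) *
  (2 * lee_coef (structure_coef q) a))) => //.
  by move=> q _; rewrite pairing_frame_form.
apply: (smooth_fun_sum oV) => a; apply: (smooth_funM oV); first exact: smooth_frame_coef.
apply: (smooth_funM oV (smooth_fun_cst _ oV)).
exact: smooth_fun_sub VU (smooth_lee_coef _).
Qed.

End Preserve.

(** * Integrability and real index in a null frame *)

Section NullFrame.
Variables (R : realType) (M : manifold R 4) (g : metric M) (N : M -> 'M[R[i]]_4).
Local Notation C := R[i].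
Local Notation eta := (eta R[i]).
Hypothesis hN : null_plane_field g N.
Implicit Types (U V : set M) (p q : M) (v : 'rV[C]_4) (X Y Z : M -> 'rV[C]_4)
  (D : 'rV[C]_4 -> (M -> 'rV[C]_4) -> 'rV[C]_4).

Lemma submx_conj q (u : 'rV[C]_4) : (u <= conjM (N q))%MS -> (conjM u <= N q)%MS.
Proof. by move=> uJ; rewrite -[N q]conjMK; exact: conjM_submx. Qed.

Lemma nullJ q (u w : 'rV[C]_4) : (u <= conjM (N q))%MS -> (w <= conjM (N q))%MS ->
  inner (g q) u w = 0.
Proof.
move=> /submx_conj uN /submx_conj wN; rewrite -[u]conjMK -[w]conjMK innerJ.
by rewrite (hN.2 q _ _ uN wN) conjc0.
Qed.

Lemma section_conj U X : open U -> section_of N U X ->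
  section_of (fun q => conjM (N q)) U (fun q => conjM (X q)).
Proof.
move=> oU [sX XN]; split; first exact: smooth_field_conj.
by move=> q Uq; apply: conjM_submx; exact: XN.
Qed.

Lemma section_conjK U X : open U -> section_of (fun q => conjM (N q)) U X ->
  section_of N U (fun q => conjM (X q)).
Proof.
move=> oU [sX XN]; split; first exact: smooth_field_conj.
by move=> q Uq; apply: submx_conj; exact: XN.
Qed.

Section WeylAtFrame.
Hypothesis hint : integrable N.
Variables (U : set M) (E : 'I_4 -> M -> 'rV[C]_4).
Hypotheses (oU : open U) (nE : null_frame g N U E).
Let gE := null_frame_gram nE.

Lemma structure_coefN q c : U q -> c = i1 \/ c = i4 -> structure_coef g E q i1 i4 c = 0.
Proof.
move=> Uq c14; have s1 := frame_sectionN nE (or_introl (erefl i1)).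
have s4 := frame_sectionN nE (or_intror (erefl i4)).
have /(null_frameN nE Uq)[k1 k4] := hint oU s1 s4 Uq.
by case: c14 => ->.
Qed.

(** Conjugation commutes with the bracket, so conj N is integrable along with N. *)
Lemma structure_coefJ q c : U q -> c = i2 \/ c = i3 -> structure_coef g E q i2 i3 c = 0.
Proof.
move=> Uq c23.
have s2 := section_conjK oU (frame_sectionJ nE (or_introl (erefl i2))).
have s3 := section_conjK oU (frame_sectionJ nE (or_intror (erefl i3))).
have JJ X : (fun q => conjM (conjM (X q))) = X by rewrite funeqE => r; rewrite conjMK.
have sn X : section_of N U X -> smooth_field_near q X by move=> [sX _]; exists U.
have bJ := bracketJ (sn _ s2) (sn _ s3); rewrite !JJ in bJ.
have : (bracket (E i2) (E i3) q <= conjM (N q))%MS.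
  by rewrite bJ; apply: conjM_submx; exact: (hint oU s2 s3 Uq).
by move=> /(null_frameJ nE Uq)[k2 k3]; case: c23 => ->.
Qed.

Lemma weyl_at_frame q : U q -> weyl_at g N q (frame_weyl g E q) (frame_form g E q).
Proof.
move=> Uq; have wD := weyl_metric_frame_weyl oU gE Uq.
have KA := structure_coefA g E q.
have K141 := structure_coefN Uq (or_introl (erefl i1)).
have K144 := structure_coefN Uq (or_intror (erefl i4)).
have K232 := structure_coefJ Uq (or_introl (erefl i2)).
have K233 := structure_coefJ Uq (or_intror (erefl i3)).
split=> //.
  apply: (preserves_gamma oU gE Uq wD (null_frameN nE)); first exact: hN.2.
  move=> a b c a14 b14; rewrite (gamma_frame_weyl oU gE _ _ _ Uq).
  case: a14 => ->; case: b14 => ->.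
  - by rewrite (weyl_coef_aa KA) etaE mul0r.
  - exact: weyl_coef14.
  - exact: weyl_coef41.
  - by rewrite (weyl_coef_aa KA) etaE mul0r.
apply: (preserves_gamma oU gE Uq wD (null_frameJ nE)); first exact: nullJ.
move=> a b c a23 b23; rewrite (gamma_frame_weyl oU gE _ _ _ Uq).
case: a23 => ->; case: b23 => ->.
- by rewrite (weyl_coef_aa KA) etaE mul0r.
- exact: weyl_coef23.
- exact: weyl_coef32.
- by rewrite (weyl_coef_aa KA) etaE mul0r.
Qed.

End WeylAtFrame.

Lemma inner_nondegenerate q (u : 'rV[C]_4) :
  (forall w, inner (g q) u w = 0) -> u = 0.
Proof.
move=> u0; have uG : u *m toC (g q) = 0.
  apply: pairing_inj => w; rewrite pairing_inner u0.
  by rewrite /pairing big1 // => i _; rewrite mxE mul0r.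
rewrite -[u]mulmx1; have <- : toC (1%:M : 'M[R]_4) = 1%:M :> 'M[C]_4.
  exact: (map_mx1 (real_complex R)).
by rewrite -(mulmxV (gram_nondegenerate g q)) toC_mul mulmxA uG mul0mx.
Qed.

Lemma rank2_independent (x y : 'rV[C]_4) a b : \rank (x + y)%MS = 2 ->
  a *: x + b *: y = 0 -> a = 0 /\ b = 0.
Proof.
have key (x' y' : 'rV[C]_4) a' b' : \rank (x' + y')%MS = 2 -> a' *: x' + b' *: y' = 0 -> a' = 0.
  move=> r2 e; apply/eqP/negPn/negP => a0.
  have xy : x' = (- (a'^-1 * b')) *: y'.
    apply: (scalerI a0); rewrite scalerA mulrN mulVKf // scaleNr.
    by apply/eqP; rewrite -addr_eq0 e.
  have : (\rank (x' + y')%MS <= \rank y')%N.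
    by apply: mxrankS; rewrite addsmx_sub submx_refl andbT xy; exact: scalemx_sub.
  by rewrite r2 => /leq_trans/(_ (rank_leq_row y')).
move=> r2 e; split; first exact: key r2 e.
by apply: (key y x b a); [rewrite addsmxC|rewrite addrC].
Qed.

Hypothesis hidx : forall p, real_index N p = 0%N.

(** Real index 0 enters here: N and conj N have rank 2 and meet in 0, so they span by the dimension
    formula, and u is orthogonal to everything. *)
Lemma orthogonal_eq0 q (x y u : 'rV[C]_4) : (N q == x + y)%MS ->
  inner (g q) u x = 0 -> inner (g q) u y = 0 ->
  inner (g q) u (conjM x) = 0 -> inner (g q) u (conjM y) = 0 -> u = 0.
Proof.
move=> /eqmxP Nxy ux uy ucx ucy; apply: inner_nondegenerate => w.
have rJ : \rank (conjM (N q)) = 2 by rewrite -(hN.1.1 q); exact: (mxrank_map (@conjc R)).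
have full : row_full (N q + conjM (N q))%MS.
  have := mxrank_sum_cap (N q) (conjM (N q)).
  by rewrite rJ (hN.1.1 q) -/(real_index N q) hidx addn0 /row_full => ->.
have orth (L : 'M[C]_4) (a b : 'rV[C]_4) z : (L <= a + b)%MS -> (z <= L)%MS ->
    inner (g q) u a = 0 -> inner (g q) u b = 0 -> inner (g q) u z = 0.
  move=> La zL ua ub; have /sub_addsmxP[[c d] /= ->] := submx_trans zL La.
  by rewrite [c]mx11_scalar [d]mx11_scalar !mul_scalar_mx innerDr !innerZr ua ub !mulr0 addr0.
have /sub_addsmxP[cd ->] := submx_full w full.
apply: (etrans (innerDr _ _ _ _)).
have NL : (N q <= x + y)%MS by rewrite Nxy.
have JL : (conjM (N q) <= conjM x + conjM y)%MS.
  have /sub_addsmxP[cd' ->] := NL.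
  by rewrite conjMD !conjM_mul addmx_sub_adds ?submxMl.
apply: (etrans (congr2 +%R (orth _ _ _ _ NL (submxMl _ _) ux uy)
  (orth _ _ _ _ JL (submxMl _ _) ucx ucy))).
exact: addr0.
Qed.

End NullFrame.

(** * The canonical Weyl connection *)

Section Canonical.
Variables (R : realType) (M : manifold R 4) (g : metric M) (N : M -> 'M[R[i]]_4).
Local Notation C := R[i].
Local Notation eta := (eta R[i]).
Hypotheses (hN : null_plane_field g N) (hidx : forall p, real_index N p = 0%N).
Implicit Types (U V : set M) (p q : M) (v : 'rV[C]_4) (X Y Z : M -> 'rV[C]_4)
  (D : 'rV[C]_4 -> (M -> 'rV[C]_4) -> 'rV[C]_4).

(* Completes a basis x, y of N by the basis of conj N dual to it under g; the
   pairing of N with conj N is perfect because both are null and span. *)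
Lemma null_frame_exists p : exists U E, [/\ open U, U p & null_frame g N U E].
Proof.
have [U [X [Y [oU Up sX sY NXY]]]] := hN.1.2 p.
pose J (Z : M -> 'rV[C]_4) q := conjM (Z q).
have sJ Z : smooth_field U Z -> smooth_field U (J Z) by exact: smooth_field_conj.
pose h (Z W : M -> 'rV[C]_4) q := inner (g q) (Z q) (J W q).
have sh Z W : smooth_field U Z -> smooth_field U W -> smooth_fun U (h Z W).
  by move=> sZ sW; apply: gram_smooth => //; exact: sJ.
(* Determinant of the pairing of N with conj N in the bases X, Y and conj X, conj Y. *)
pose det q := h X X q * h Y Y q - h X Y q * h Y X q.
have XN q : U q -> (X q <= N q)%MS.
  by move=> /NXY /eqmxP Nq; rewrite Nq addsmxSl.
have YN q : U q -> (Y q <= N q)%MS.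
  by move=> /NXY /eqmxP Nq; rewrite Nq addsmxSr.
have indep q a b : U q -> a *: X q + b *: Y q = 0 -> a = 0 /\ b = 0.
  move=> Uq; apply: rank2_independent; rewrite -(hN.1.1 q); symmetry.
  by have /eqmxP -> := NXY q Uq.
have det0 q : U q -> det q != 0.
  move=> Uq; apply/negP => /eqP d0.
  have null u w : (u <= N q)%MS -> (w <= N q)%MS -> inner (g q) u w = 0 by apply: hN.2.
  have zero a b : a * h X X q + b * h Y X q = 0 -> a * h X Y q + b * h Y Y q = 0 ->
      a = 0 /\ b = 0.
    move=> e1 e2; apply: (indep q a b Uq).
    have uN : ((a *: X q + b *: Y q)%R <= N q)%MS.
      by apply: addmx_sub; apply: scalemx_sub; [exact: XN|exact: YN].
    apply: (orthogonal_eq0 hN hidx (NXY q Uq)).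
    - exact: null uN (XN q Uq).
    - exact: null uN (YN q Uq).
    - by rewrite innerDl !innerZl.
    - by rewrite innerDl !innerZl.
  have [hYY hXY] : h Y Y q = 0 /\ - h X Y q = 0.
    by apply: zero; [rewrite -d0 /det; ring|ring].
  have [hYX hXX] : - h Y X q = 0 /\ h X X q = 0.
    by apply: zero; [ring|rewrite -d0 /det; ring].
  have [one _] : (1 : C) = 0 /\ (0 : C) = 0.
    apply: zero; rewrite ?mul1r ?mul0r ?addr0 //.
    by apply/eqP; rewrite -oppr_eq0 hXY.
  by have := oner_neq0 C; rewrite one eqxx.
(* Cramer's rule for g(X, Z1) = g(Y, Z2) = 1 and g(X, Z2) = g(Y, Z1) = 0. *)
pose Z1 q := (det q)^-1 *: (h Y Y q *: J X q + (- h Y X q) *: J Y q).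
pose Z2 q := (det q)^-1 *: (h X X q *: J Y q + (- h X Y q) *: J X q).
pose E (a : 'I_4) := match val a with 0 => X | 1 => Z1 | 2 => Z2 | _ => Y end%N.
have sdet : smooth_fun U (fun q => (det q)^-1).
  apply: smooth_funV => //; apply: (smooth_funD oU).
    by apply: (smooth_funM oU); exact: sh.
  by apply: (smooth_funN oU); apply: (smooth_funM oU); exact: sh.
have sE a : smooth_field U (E a).
  have comb f1 f2 F1 F2 : smooth_fun U f1 -> smooth_fun U f2 -> smooth_field U F1 ->
      smooth_field U F2 ->
      smooth_field U (fun q => (det q)^-1 *: (f1 q *: F1 q + (- f2 q) *: F2 q)).
    move=> s1 s2 s3 s4; apply: (smooth_fieldZ oU sdet); apply: (smooth_fieldD oU).
      exact: (smooth_fieldZ oU).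
    by apply: (smooth_fieldZ oU) => //; exact: (smooth_funN oU).
  elim/ord4P: a => //; apply: comb; do ?exact: sh; exact: sJ.
have JN Z q : (Z q <= N q)%MS -> (J Z q <= conjM (N q))%MS by exact: conjM_submx.
have ZJ q a b : U q -> ((a *: J X q + b *: J Y q)%R <= conjM (N q))%MS.
  move=> Uq; apply: addmx_sub; apply: scalemx_sub; apply: JN; [exact: XN|exact: YN].
have Z1J q : U q -> (Z1 q <= conjM (N q))%MS.
  by move=> Uq; apply: scalemx_sub; exact: ZJ.
have Z2J q : U q -> (Z2 q <= conjM (N q))%MS.
  by move=> Uq; apply: scalemx_sub; rewrite addrC; exact: ZJ.
exists U, E; split=> //; apply: null_frameP => //; last first.
- by move=> q Uq; split; [exact: Z1J|exact: Z2J].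
- by move=> q Uq; split; [exact: XN|exact: YN].
move=> q Uq; have d0 := det0 q Uq.
have s u w : inner (g q) u w = inner (g q) w u by apply: inner_sym; exact: gram_sym.
have NN := hN.2 q; have CC := @nullJ _ _ _ _ hN q.
have X1 : inner (g q) (X q) (Z1 q) = 1.
  rewrite innerZr innerDr !innerZr -[1](mulVf d0); congr (_ * _).
  by rewrite /det /h; ring.
have X2 : inner (g q) (X q) (Z2 q) = 0.
  by rewrite innerZr innerDr !innerZr -/(h X Y q) -/(h X X q); ring.
have Y1 : inner (g q) (Y q) (Z1 q) = 0.
  by rewrite innerZr innerDr !innerZr -/(h Y Y q) -/(h Y X q); ring.
have Y2 : inner (g q) (Y q) (Z2 q) = 1.
  rewrite innerZr innerDr !innerZr -[1](mulVf d0); congr (_ * _).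
  by rewrite /det /h; ring.
have [nX nY n1 n2] : [/\ (X q <= N q)%MS, (Y q <= N q)%MS, (Z1 q <= conjM (N q))%MS
  & (Z2 q <= conjM (N q))%MS] by split; [exact: XN|exact: YN|exact: Z1J|exact: Z2J].
move=> a b; elim/ord4P: a; elim/ord4P: b; rewrite etaE.
- exact: (NN _ _ nX nX).
- exact: X1.
- exact: X2.
- exact: (NN _ _ nX nY).
- exact: (etrans (s _ _) X1).
- exact: (CC _ _ n1 n1).
- exact: (CC _ _ n1 n2).
- exact: (etrans (s _ _) Y1).
- exact: (etrans (s _ _) X2).
- exact: (CC _ _ n2 n1).
- exact: (CC _ _ n2 n2).
- exact: (etrans (s _ _) Y2).
- exact: (NN _ _ nY nX).
- exact: Y1.
- exact: Y2.
- exact: (NN _ _ nY nY).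
Qed.

Lemma derivation_conj p D : derivation_at p D ->
  derivation_at p (fun v Y => conjM (D (conjM v) (fun q => conjM (Y q)))).
Proof.
move=> dD; split=> [a u v Y sY|v Y Z sY sZ|v f Y sf sY].
- rewrite conjMD conjMZ (derivation_linear dD _ _ _ (smooth_field_near_conj sY)).
  by rewrite conjMD conjMZ conjcK.
- have -> : (fun q => conjM (Y q + Z q)) = (fun q => conjM (Y q) + conjM (Z q)).
    by rewrite funeqE => q; rewrite conjMD.
  rewrite (derivation_add dD _ (smooth_field_near_conj sY) (smooth_field_near_conj sZ)).
  by rewrite conjMD.
- have -> : (fun q => conjM (f q *: Y q)) = (fun q => ((f q)^*)%C *: conjM (Y q)).
    by rewrite funeqE => q; rewrite conjMZ.
  have sfJ : smooth_fun_near p (fun q => (f q)^*).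
    by have [U [oU Up fU]] := sf; exists U; split=> //; exact: smooth_fun_conj.
  rewrite (derivation_leibniz dD (conjM v) sfJ (smooth_field_near_conj sY)).
  by rewrite conjMD !conjMZ conjMK conjcK (dir_derivJ v sf) conjcK.
Qed.

(** Brackets, g and directional derivatives commute with conjugation, which exchanges the conditions
    on N and on conj N. *)
Lemma weyl_at_conj p D b : weyl_at g N p D b ->
  weyl_at g N p (fun v Y => conjM (D (conjM v) (fun q => conjM (Y q)))) (conjM b).
Proof.
move=> [wD pN pJ]; split.
- split; first exact: derivation_conj (weyl_derivation wD).
    move=> X Y sX sY; have sXJ := smooth_field_near_conj sX.
    have sYJ := smooth_field_near_conj sY.
    by rewrite -conjMB (weyl_torsion wD sXJ sYJ) (bracketJ sX sY) conjMK.
  move=> v X Y sX sY; have sXJ := smooth_field_near_conj sX.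
  have sYJ := smooth_field_near_conj sY.
  apply: (can_inj (@conjcK R)).
  have e := weyl_metric wD (conjM v) sXJ sYJ.
  have E : \forall q \near p, inner (g q) (conjM (X q)) (conjM (Y q)) =
      (inner (g q) (X q) (Y q))^*.
    by apply: nearW => q; rewrite innerJ.
  rewrite (eq_dir_deriv _ E) (dir_derivJ v (smooth_inner_near g sX sY)) in e.
  rewrite -[D (conjM v) (fun q => conjM (X q))]conjMK
    -[D (conjM v) (fun q => conjM (Y q))]conjMK -{1}[b]conjMK !innerJ pairingJ in e.
  by rewrite rmorphB rmorphB rmorphN rmorphM; exact: e.
- move=> v U Y oU Up sY; apply: (@submx_conj _ _ N p).
  exact: pJ oU Up (section_conj oU sY).
- by move=> v U Y oU Up sY; apply: conjM_submx; exact: pN oU Up (section_conjK oU sY).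
Qed.

Lemma weyl_at_unique_near p D D' b b' : weyl_at g N p D b -> weyl_at g N p D' b' ->
  b = b' /\ (forall v Y, smooth_field_near p Y -> D v Y = D' v Y).
Proof.
have [U [E [oU Up nE]]] := null_frame_exists p.
exact: (weyl_at_unique oU Up nE).
Qed.

Lemma derivation_connection (D : connection M) p : derivation_at p (D p).
Proof.
split=> [a u v Y|v Y Z|v f Y]; [exact: cov_linear|exact: cov_add|exact: cov_leibniz].
Qed.

Lemma weyl_metric_connection (D : connection M) (B : M -> 'rV[R]_4) p : torsionless D ->
  weyl_condition g D B -> weyl_metric_at g p (D p) (toC (B p)).
Proof.
move=> tD wD; split; first exact: derivation_connection.
  by move=> X Y sX sY; exact: tD.
by move=> v X Y sX sY; exact: wD.
Qed.

Lemma weyl_at_connection (D : connection M) (B : M -> 'rV[R]_4) p :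
  real_connection D -> torsionless D -> weyl_condition g D B -> preserves D N ->
  weyl_at g N p (D p) (toC (B p)).
Proof.
move=> rD tD wD pD.
have pN : preserves_at p (D p) N.
  move=> v U Y oU Up sY; have sYn : smooth_field_near p Y by exists U; split=> //; exact: sY.1.
  (* [preserves] speaks of real directions only; a complex one is split into real and imaginary
     parts. *)
  have -> : v = 'i *: toC (map_mx (@complex.Im R) v) + toC (map_mx (@complex.Re R) v).
    by apply/rowP => j; rewrite !mxE addrC -complexE.
  rewrite cov_linear //; apply: addmx_sub; last exact: pD oU Up sY.
  by apply: scalemx_sub; exact: pD oU Up sY.
split=> //; first exact: weyl_metric_connection.
(* Reality of D carries preservation from N to conj N. *)
move=> v U Y oU Up sY; have sYn : smooth_field_near p Y by exists U; split=> //; exact: sY.1.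
rewrite -[D p v Y]conjMK -(rD p v Y sYn); apply: conjM_submx.
exact: pN oU Up (section_conjK oU sY).
Qed.

Hypothesis hint : integrable N.

Lemma canonical_weyl_exists : exists W : connection M, canonical_weyl g N W.
Proof.
have ex p : exists UE : set M * ('I_4 -> M -> 'rV[C]_4),
    [/\ open UE.1, UE.1 p & null_frame g N UE.1 UE.2].
  by have [U [E UE]] := null_frame_exists p; exists (U, E).
(* One frame is chosen for each point, and W uses its operator at that point only; the choices at
   different points are related by uniqueness alone. *)
have [F FP] := choice ex.
pose W p := frame_weyl g (F p).2 p; pose beta p := frame_form g (F p).2 p.
have WP p : weyl_at g N p (W p) (beta p).
  have [oU Up nE] := FP p; exact: (weyl_at_frame hN hint oU nE Up).
(* For smoothness near p: the operators of the single frame chosen at p solve the same equations at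
   all nearby q, so they coincide there with [W q]. *)
have local p U : open U -> U p -> exists V E, [/\ open V, V p, V `<=` U, gram_frame g V E &
    forall q, V q -> weyl_at g N q (frame_weyl g E q) (frame_form g E q)].
  move=> oU Up; have [oV Vp nE] := FP p.
  exists ((F p).1 `&` U), (F p).2; split.
  - exact: openI.
  - by split.
  - by move=> q [].
  - have [sE gE] := null_frame_gram nE; split=> [a|q [Vq _]]; last exact: gE.
    by apply: smooth_field_sub (sE a) => q [].
  - by move=> q [Vq _]; exact: (weyl_at_frame hN hint oV nE Vq).
have dW p := weyl_derivation (weyl_at_metric (WP p)).
have sW U X Y : open U -> smooth_field U X -> smooth_field U Y ->
    smooth_field U (fun q => W q (X q) Y).
  move=> oU sX sY; apply: smooth_field_local => p Up.
  have [V [E [oV Vp VU gE wE]]] := local p U oU Up; exists V => //.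
  have sXV := smooth_field_sub VU sX; have sYV := smooth_field_sub VU sY.
  apply: smooth_field_ext (smooth_frame_weyl oV gE oV (fun q Vq => Vq) sXV sYV) => //.
  move=> q Vq; have [_] := weyl_at_unique_near (wE q Vq) (WP q); apply.
  by exists V.
pose conn := @Connection R 4 M W (fun p => derivation_linear (dW p))
  (fun p => derivation_add (dW p)) (fun p => derivation_leibniz (dW p)) sW.
(* The conjugate operator solves the same equations, so uniqueness makes both W and [beta] real. *)
have real p : conjM (beta p) = beta p /\
    (forall v Y, smooth_field_near p Y ->
       conjM (W p (conjM v) (fun q => conjM (Y q))) = W p v Y).
  exact: weyl_at_unique_near (weyl_at_conj (WP p)) (WP p).
pose B p : 'rV[R]_4 := map_mx (@complex.Re R) (beta p).
have BE p : toC (B p) = beta p.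
  apply/rowP => j; rewrite !mxE; have [/rowP/(_ j) + _] := real p.
  rewrite mxE; case: (beta p 0 j) => x y /= [] /eqP.
  by rewrite -subr_eq0 -opprD oppr_eq0 -mulr2n mulrn_eq0 /= => /eqP ->.
exists conn; split.
- move=> p v Y sY /=; have [_ rW] := real p.
  by rewrite -[LHS]conjMK; congr conjM; exact: rW.
- by move=> p X Y sX sY; exact: (weyl_torsion (weyl_at_metric (WP p))).
- exists B; last by move=> p v X Y sX sY; rewrite BE; exact: (weyl_metric (weyl_at_metric (WP p))).
  move=> U X oU _ sX; apply: smooth_fun_local => p Up.
  have [V [E [oV Vp VU gE wE]]] := local p U oU Up; exists V => //.
  have sXV := smooth_field_sub VU sX.
  apply: smooth_fun_ext (smooth_frame_form oV gE oV (fun q Vq => Vq) sXV) => //.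
  move=> q Vq; have [e _] := weyl_at_unique_near (wE q Vq) (WP q).
  by rewrite BE e.
- by move=> p v U Y oU Up sY; exact: (weyl_atN (WP p)) oU Up sY.
Qed.

End Canonical.

(** * Adapted coframes *)

Section Coframe.
Variables (R : realType) (M : manifold R 4) (g : metric M) (N : M -> 'M[R[i]]_4).
Local Notation C := R[i].
Local Notation eta := (eta R[i]).
Variables (s : signature) (U : set M) (th : M -> 'M[C]_4).
Hypotheses (hN : null_plane_field g N) (hidx : forall p, real_index N p = 0%N)
  (oU : open U) (ath : adapted_coframe g N U th) (rth : reality_conditions s U th).

Lemma theta_frame q a b : U q -> pairing (theta th a q) (frame th b q) = (a == b)%:R.
Proof.
move=> Uq; have [[_ uth] _ _] := ath.
transitivity ((th q *m invmx (th q)) a b); last by rewrite (mulmxV (uth q Uq)) mxE.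
rewrite [RHS]mxE; apply: eq_bigr => i _.
by rewrite /theta /frame /dual_frame [row a _ _ _]mxE [row b _ _ _]mxE [_^T _ _]mxE.
Qed.

Lemma inner_coframe q b w : U q ->
  inner (g q) (frame th b q) w = pairing (theta th (dual_index b) q) w.
Proof.
move=> Uq; have [_ gth _] := ath.
rewrite (gth q Uq (frame th b q) w) !(theta_frame _ _ Uq).
by elim/ord4P: b; rewrite /= ?(mul0r, mul1r, add0r, addr0).
Qed.

Lemma coframe_gram q a b : U q -> inner (g q) (frame th a q) (frame th b q) = eta a b.
Proof.
by move=> Uq; rewrite (inner_coframe _ _ Uq) (theta_frame _ _ Uq) /eta eq_sym.
Qed.

(** The definition of a coframe gives smoothness of the theta^a only. In a smooth null frame E the
    coefficients of e_b are values of theta^([dual_index b]) on fields of E, hence smooth, without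
    inverting a matrix of functions. *)
Lemma frame_smooth b : smooth_field U (frame th b).
Proof.
apply: smooth_field_local => p Up.
have [V [E [oV Vp nE]]] := null_frame_exists hN hidx p.
have oUV := openI oU oV; exists (U `&` V) => //.
have gE := null_frame_gram nE.
have sE a : smooth_field (U `&` V) (E a).
  by apply: smooth_field_sub (gram_frame_smooth gE a) => q [].
have [[sth _] _ _] := ath.
apply: (@smooth_field_ext _ _ _ _ (fun q => \sum_a
   pairing (theta th (dual_index b) q) (E (dual_index a) q) *: E a q)) => //.
  move=> q [Uq Vq]; rewrite [RHS](frame_coord gE _ Vq); apply: eq_bigr => a _.
  by rewrite /frame_coef (inner_coframe _ _ Uq).
apply: (smooth_field_sum oUV) => a; apply: (smooth_fieldZ oUV) => //.
by apply: (sth _ _ _ oUV) => // q [].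
Qed.

(** In the second part only vanishing matters, so the sign that distinguishes the signatures
    disappears. *)
Lemma theta_conj q w : U q ->
  pairing (theta th i2 q) (conjM w) = (pairing (theta th i1 q) w)^* /\
  (pairing (theta th i4 q) w = 0 -> pairing (theta th i3 q) (conjM w) = 0).
Proof.
move=> Uq; have [-> t4] := rth Uq; split; first exact: pairingJ.
rewrite t4; case: s => [|]; rewrite -{2}[theta th i3 q]conjMK pairingJ; first by move=> ->; rewrite conjc0.
rewrite -scaleN1r pairingZl mulN1r => /eqP; rewrite oppr_eq0 => /eqP ->.
exact: conjc0.
Qed.

Lemma coframe_null_frame : null_frame g N U (frame th).
Proof.
have [_ _ Nth] := ath.
have EN q : U q -> (frame th i1 q <= N q)%MS /\ (frame th i4 q <= N q)%MS.
  by move=> /Nth /eqmxP Nq; rewrite !Nq addsmxSl addsmxSr.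
apply: null_frameP => //; [exact: frame_smooth|by move=> q Uq a b; exact: coframe_gram|].
move=> q Uq; have [N1 N4] := EN q Uq.
have inN (u : 'rV[C]_4) : (u <= N q)%MS <->
    inner (g q) u (frame th i1 q) = 0 /\ inner (g q) u (frame th i4 q) = 0.
  apply: (lagrangian (E := fun a => frame th a q)) => //; last exact: hN.2.
    by move=> a b; exact: coframe_gram.
  by apply/seteqP; split=> // a _; elim/ord4P: a;
    [left; left; left|left; right|right|left; left; right].
(* For b = 2, 3 the vector conj e_b is orthogonal to e1 and e4: these products are theta^2 and
   theta^3 of conj e_b, which the reality conditions relate to theta^1 and theta^4 of e_b. *)
have key b : b != i1 -> b != i4 -> (frame th b q <= conjM (N q))%MS.
  move=> b1 b4; rewrite -[frame th b q]conjMK; apply: conjM_submx; apply/inN.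
  have sy u w : inner (g q) u w = inner (g q) w u by apply: inner_sym; exact: gram_sym.
  rewrite !(sy (conjM _)) !(inner_coframe _ _ Uq).
  have [t2 t3] := theta_conj (frame th b q) Uq; split.
    by rewrite [LHS]t2 (theta_frame _ _ Uq) eq_sym (negPf b1) conjc0.
  by apply: t3; rewrite (theta_frame _ _ Uq) eq_sym (negPf b4).
by split; apply: key.
Qed.

(** Taking components with the theta^d and lowering the index with g amounts to the product with
    e_a. *)
Lemma Gamma_gamma (D : connection M) a b c p : U p ->
  Gamma g D th a b c p = gamma g (frame th) p (D p) a b c.
Proof.
move=> Up; have gE := null_frame_gram coframe_null_frame.
have sy u w : inner (g p) u w = inner (g p) w u by apply: inner_sym; exact: gram_sym.
rewrite /gamma sy [X in inner _ _ X](frame_coord gE _ Up).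
have -> (F : 'I_4 -> 'rV[C]_4) u : inner (g p) u (\sum_d F d) = \sum_d inner (g p) u (F d).
  by rewrite sy inner_suml; apply: eq_bigr => d _; exact: sy.
apply: eq_bigr => d _; rewrite innerZr mulrC; congr (_ * _).
by rewrite /frame_coef sy (inner_coframe _ _ Up) dual_indexK.
Qed.

End Coframe.

Theorem theorem7p13 (R : realType) (M : manifold R 4) (s : signature)
    (g : metric M) (N : M -> 'M[R[i]]_4)
    (hs : has_signature s g)
    (hN : null_plane_field g N)
    (hint : integrable N)
    (hidx : forall p, real_index N p = 0%N) :
  exists W : connection M,
    [/\ canonical_weyl g N W,
        forall W' : connection M, canonical_weyl g N W' -> same_connection W' W &
        forall (B : M -> 'rV[R]_4) (LC : connection M)
               (U : set M) (th : M -> 'M[R[i]]_4),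
          real_one_form B -> weyl_condition g W B -> levi_civita g LC ->
          open U -> adapted_coframe g N U th -> reality_conditions s U th ->
          forall p, U p ->
            let B_ a := pairing (toC (B p)) (frame th a p) in
            let G a b c := Gamma g LC th a b c p in
            let g_ a b := g_low g th a b p in
            2^-1 *: toC (B p) = G i1 i4 i3 *: theta th i1 p
                              + G i2 i3 i4 *: theta th i2 p
                              + G i3 i2 i1 *: theta th i3 p
                              + G i4 i1 i2 *: theta th i4 p
            /\ forall a b c,
                 Gamma g W th a b c p =
                 G a b c + 2^-1 * (g_ c a * B_ b - g_ c b * B_ a + g_ a b * B_ c)].
Proof.
have [W cW] := canonical_weyl_exists hN hidx hint.
have [rW tW _ pW] := cW.
exists W; split=> //.
  move=> W' [rW' tW' [B' _ wB'] pW'] p v Y sY.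
  have [_ _ [B _ wB] _] := cW.
  have wW' := weyl_at_connection p rW' tW' wB' pW'.
  have wW := weyl_at_connection p rW tW wB pW.
  by have [_] := weyl_at_unique_near hN hidx wW' wW; apply.
move=> B LC U th _ wB [_ tLC mLC] oU ath rth p Up B_ G g_.
have nE := coframe_null_frame hN hidx oU ath rth.
have gE := null_frame_gram nE.
have wW := weyl_at_connection p rW tW wB pW.
have p0 v : pairing (0 : 'rV[R[i]]_4) v = 0.
  by rewrite /pairing big1 // => i _; rewrite mxE mul0r.
(* The Levi-Civita connection is compared with W as a Weyl operator with form 0. *)
have wLC : weyl_metric_at g p (LC p) 0.
  split; first exact: derivation_connection.
    by move=> X Y sX sY; exact: tLC.
  by move=> v X Y sX sY; rewrite p0 mul0r oppr0; exact: mLC.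
have GE D a b c := Gamma_gamma hN hidx oU ath rth D a b c Up.
split.
  have [f1 f2 f3 f4] := weyl_at_form oU Up nE wW wLC.
  rewrite !p0 !subr0 in f1 f2 f3 f4.
  rewrite /G !GE -f1 -f2 -f3 -f4.
  (* Both covectors are evaluated on the frame, where duality reads off the right side. *)
  apply: pairing_inj => w.
  rewrite (pairing_frame Up gE) [RHS](pairing_frame Up gE).
  apply: eq_bigr => c _; congr (_ * _).
  rewrite !pairingDl !pairingZl !(theta_frame ath _ _ Up).
  by elim/ord4P: c; rewrite /= ?(mulr0, mulr1, add0r, addr0).
move=> a b c; rewrite /G !GE.
have g_E i j : g_ i j = eta R[i] i j by exact: (coframe_gram ath).
have := frame_diff oU Up gE a b c (weyl_at_metric wW) wLC.
rewrite !p0 !subr0 -!g_E => /eqP; rewrite subr_eq => /eqP ->.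
exact: addrC.
Qed.
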